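(* Let $G$ be a discrete group, $\sigma$ a two-cocycle on $G$, and $H$ a subgroup of $G$. The following conditions are equivalent: (i) $(H\le G,\sigma)$ satisfies the relative Kleppner condition. (ii) Every $C^*$-algebra $A$ satisfying $C^*_r(H,\sigma)\subseteq A\subseteq C^*_r(G,\sigma)$ is prime. (iii) Every $C^*$-algebra $A$ satisfying $C^*_r(H,\sigma)\subseteq A\subseteq C^*_r(G,\sigma)$ has trivial center.
   Context: A two-cocycle on a discrete group $G$ (identity $e$) is a map $\sigma\colon G\times G\to\mathbb{T}$ (unit circle) with $\sigma(g,h)\sigma(gh,k)=\sigma(g,hk)\sigma(h,k)$ and $\sigma(g,e)=\sigma(e,g)=1$ for all $g,h,k\in G$. Its restriction to a subgroup is again denoted $\sigma$. The operators $\lambda_\sigma(g)$ on $\ell^2(G)$ are given by $(\lambda_\sigma(g)\xi)(h)=\sigma(g,g^{-1}h)\xi(g^{-1}h)$. $C^*_r(G,\sigma)$ is the $C^*$-subalgebra of $B(\ell^2(G))$ generated by $\lambda_\sigma(G)$. For a subgroup $H\le G$, $C^*_r(H,\sigma)$ is identified with the $C^*$-subalgebra of $C^*_r(G,\sigma)$ generated by $\lambda_\sigma(H)$. A $C^*$-algebra is prime if any two nonzero (closed two-sided) ideals have nonzero intersection. Trivial center means center equal to $\mathbb{C}1$. For $g\in G$, the $H$-conjugacy class of $g$ is $g^H=\{hgh^{-1}:h\in H\}$; it is nontrivial if $g\ne e$. An element $g\in G$ is $\sigma$-regular w.r.t. $H$ if $\sigma(g,h)=\sigma(h,g)$ whenever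 $h\in H$ and $gh=hg$; this is a property of $H$-conjugacy classes. $(H\le G,\sigma)$ satisfies the relative Kleppner condition if every nontrivial $H$-conjugacy class in $G$ that is $\sigma$-regular w.r.t. $H$ is infinite. *)

(* Defs.v *)
(* MathComp-Analysis; the complex numbers are R[i] for R : realType. *)
From HB Require Import structures.
From mathcomp Require Import all_boot all_order all_algebra.
From mathcomp Require Import all_classical all_reals all_analysis.
From mathcomp Require Import complex ring.

Set Implicit Arguments.
Unset Strict Implicit.
Unset Printing Implicit Defensive.

Import Order.TTheory GRing.Theory Num.Theory.

Local Open Scope classical_set_scope.
Local Open Scope ring_scope.
Local Open Scope complex_scope.

Section hilbert_space.
Context {R : realType} {G : choiceType}.
Implicit Types x y : G -> R[i].

Definition sqmod (z : R[i]) : R := complex.Re z ^+ 2 + complex.Im z ^+ 2.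

Definition sqsum x : \bar R := \esum_(g in setT) (sqmod (x g))%:E.

Definition square_summable : {pred G -> R[i]} :=
  fun x => `[< (sqsum x < +oo)%E >].

Lemma sqmod_ge0 z : 0 <= sqmod z.
Proof. by rewrite addr_ge0 ?sqr_ge0. Qed.

Lemma sqmodM z w : sqmod (z * w) = sqmod z * sqmod w.
Proof. by case: z w => [a b] [c d]; rewrite /sqmod /=; ring. Qed.

Lemma sqmodD z w : sqmod (z + w) <= 2 * sqmod z + 2 * sqmod w.
Proof.
case: z w => [a b] [c d]; rewrite /sqmod /= -subr_ge0.
suff -> : 2 * (a ^+ 2 + b ^+ 2) + 2 * (c ^+ 2 + d ^+ 2) -
  ((a + c) ^+ 2 + (b + d) ^+ 2) = (a - c) ^+ 2 + (b - d) ^+ 2.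
  by rewrite addr_ge0 ?sqr_ge0.
by ring.
Qed.

Lemma sqmodE (z : R[i]) : (sqmod z)%:C = `|z| ^+ 2.
Proof. by rewrite normc_def -rmorphXn sqr_sqrtr // sqmod_ge0. Qed.

Lemma square_summable_submod_closed : submod_closed square_summable.
Proof.
have sqsum_fin z : (sqsum z < +oo)%E -> (fine (sqsum z))%:E = sqsum z.
  move=> zlt; rewrite fineK// ge0_fin_numE// esum_ge0// => g _.
  by rewrite lee_fin sqmod_ge0.
split.
  apply/asboolP; rewrite /sqsum esum1 ?ltry// => g _.
  by rewrite /sqmod/= expr0n/= addr0.
move=> a x y /asboolP xfin /asboolP yfin; apply/asboolP.
pose M := 2 * (sqmod a * fine (sqsum x)) + 2 * fine (sqsum y).
apply: (@le_lt_trans _ _ M%:E); last exact: ltry.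
apply: ge_ereal_sup => _ [F [finF _] <-].
have bound z : (sqsum z < +oo)%E ->
    \sum_(g \in F) sqmod (z g) <= fine (sqsum z).
  move=> zfin; rewrite -lee_fin sqsum_fin// -fsumEFin//.
  by apply: ereal_sup_ubound; exists F.
rewrite fsumEFin// lee_fin.
have le1 : \sum_(g \in F) sqmod ((a *: x + y) g) <=
    2 * (sqmod a * \sum_(g \in F) sqmod (x g)) +
    2 * \sum_(g \in F) sqmod (y g).
  rewrite !fsbig_finite//= !mulr_sumr -big_split/=; apply: ler_sum => g _.
  by rewrite -sqmodM; exact: sqmodD.
apply: (le_trans le1); rewrite lerD// ler_wpM2l// ?bound//.
by rewrite ler_wpM2l ?sqmod_ge0 ?bound.
Qed.

HB.instance Definition _ := GRing.isSubmodClosed.Build R[i] (G -> R[i])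
  square_summable square_summable_submod_closed.

End hilbert_space.

Record ell2 (R : realType) (G : choiceType) := Ell2 {
  ell2_val :> G -> R[i];
  ell2_valP : ell2_val \in square_summable }.

HB.instance Definition _ (R : realType) (G : choiceType) :=
  [isSub of ell2 R G for @ell2_val R G].
HB.instance Definition _ (R : realType) (G : choiceType) :=
  [Choice of ell2 R G by <:].
HB.instance Definition _ (R : realType) (G : choiceType) :=
  [SubChoice_isSubLmodule of ell2 R G by <:].

Section operators.
Context {R : realType} {G : choiceType}.
Local Notation V := (ell2 R G).
Implicit Types (x y : V) (S T : V -> V) (A J K : set (V -> V)).

Definition l2norm x : R := Num.sqrt (fine (sqsum x)).

(* Unordered sums of absolutely summable families. *)
Definition rsum (f : G -> R) : R :=
  fine (\esum_(g in setT) ((EFin \o f)^\+ g) -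
        \esum_(g in setT) ((EFin \o f)^\- g))%E.

Definition csum (f : G -> R[i]) : R[i] :=
  (rsum (fun g => complex.Re (f g))) +i* (rsum (fun g => complex.Im (f g))).

Definition inner x y : R[i] := csum (fun g => x g * (y g)^*).

Definition bounded_operator T : Prop :=
  linear T /\ exists M : R, forall x, l2norm (T x) <= M * l2norm x.

Definition opnorm T : R := sup [set l2norm (T x) | x in [set x | l2norm x <= 1]].

Definition is_adjoint T S : Prop := forall x y, inner (T x) y = inner x (S y).

Definition norm_closed_in A J : Prop :=
  forall T, A T ->
    (forall e : R, 0 < e -> exists2 S, J S & opnorm (T - S) < e) -> J T.

(* A bounded operator has exactly one adjoint, so the existential clause below
   says that A is closed under the involution. *)
Definition cstar_subalgebra A : Prop :=
  [/\ A `<=` bounded_operator,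
      A 0 /\ forall (a : R[i]) S T, A S -> A T -> A (a *: S + T),
      forall S T, A S -> A T -> A (S \o T),
      forall T, A T -> exists2 S, A S & is_adjoint T S
    & norm_closed_in bounded_operator A].

(* Closed two-sided ideals; closedness is taken in A. *)
Definition closed_ideal A J : Prop :=
  [/\ J `<=` A,
      J 0 /\ forall (a : R[i]) S T, J S -> J T -> J (a *: S + T),
      forall S T, A S -> J T -> J (S \o T) /\ J (T \o S)
    & norm_closed_in A J].

Definition prime_algebra A : Prop :=
  forall J K, closed_ideal A J -> closed_ideal A K ->
    J <> [set 0] -> K <> [set 0] -> J `&` K <> [set 0].

Definition center A : set (V -> V) :=
  [set T | A T /\ forall S, A S -> T \o S = S \o T].

Definition trivial_center A : Prop :=
  center A = range (fun a : R[i] => a *: (idfun : V -> V)).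

End operators.

Record two_cocycle (R : realType) (G : groupType) := TwoCocycle {
  cocycle :> G -> G -> R[i];
  cocycle_norm : forall g h, `|cocycle g h| = 1;
  cocycleM : forall g h k, cocycle g h * cocycle (g * h)%g k =
                           cocycle g (h * k)%g * cocycle h k;
  cocycleg1 : forall g, cocycle g 1%g = 1;
  cocycle1g : forall g, cocycle 1%g g = 1 }.

Section twisted_group_algebra.
Context {R : realType} {G : groupType} (sigma : two_cocycle R G).

Definition twisted_shift (g : G) (x : G -> R[i]) : G -> R[i] :=
  fun h => sigma g (g^-1 * h)%g * x (g^-1 * h)%g.

Lemma twisted_shift_square_summable g (x : G -> R[i]) :
  x \in square_summable -> twisted_shift g x \in square_summable.
Proof.
move=> /asboolP xfin; apply/asboolP; apply: le_lt_trans xfin.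
rewrite [leRHS](reindex_esum setT setT (fun h => g^-1 * h)%g); last first.
  split=> // [h k _ _ /mulgI //|h _].
  by exists (g * h)%g => //; rewrite mulgA mulVg mul1g.
apply: le_esum => h _; rewrite lee_fin sqmodM.
suff -> : sqmod (sigma g (g^-1 * h)%g) = 1 by rewrite mul1r.
apply: (@complexI R).
by rewrite sqmodE cocycle_norm expr1n.
Qed.

Definition lambda (g : G) (x : ell2 R G) : ell2 R G :=
  Ell2 (twisted_shift_square_summable g (ell2_valP x)).

(* C*_r(H, sigma), realised inside the bounded operators on ell^2(G);
   C*_r(G, sigma) is the case H = setT. *)
Definition cstar_r (H : set G) : set (ell2 R G -> ell2 R G) :=
  smallest cstar_subalgebra (lambda @` H).

Definition conj_class (H : set G) (g : G) : set G :=
  [set (h * g * h^-1)%g | h in H].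

Definition regular_wrt (H : set G) (g : G) : Prop :=
  forall h, H h -> (g * h = h * g)%g -> sigma g h = sigma h g.

Definition relative_Kleppner (H : set G) : Prop :=
  forall g : G, g <> 1%g -> regular_wrt H g -> infinite_set (conj_class H g).

End twisted_group_algebra.

(* Main.v *)
Require Import Defs.
From mathcomp Require Import all_boot all_order all_algebra.
From mathcomp Require Import all_classical all_reals all_analysis.
From mathcomp Require Import finmap complex ring lra.

(* Let [delta e] be the basis vector at the identity and let [rho] be the right
   regular representation, which commutes with C*_r(G, sigma).  The unitaries
   [lambda h \o rho h] fix [delta e] and permute coordinates along conjugacy
   classes up to phases; under the relative Kleppner condition their only
   common fixed vectors, [h] ranging over [H], are the multiples of [delta e].
   A central element [T] of [A] sends [delta e] to such a fixed vector, so it is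
   scalar.  If [J] and [K] are ideals of [A] with zero intersection, the common
   kernel of [J] is invariant under [lambda @` H] and [rho], so the point of it
   nearest to [delta e] is fixed as well; hence that kernel is everything or
   zero, and since it contains the range of [K], either [J] or [K] vanishes.

   Conversely, a nontrivial finite regular class gives a finite sum commuting
   with [lambda @` H], hence a nonscalar self-adjoint [X] whose diagonal
   coefficient vanishes.  In the C*-algebra generated by [lambda @` H] and [X] it
   is central, and for [Y] proportional to [X] the elements [|Y| + Y] and
   [|Y| - Y] are nonzero with product zero, so the annihilator of [|Y| + Y] and
   the annihilator of that ideal contradict primeness. *)

Set Implicit Arguments.
Unset Strict Implicit.
Unset Printing Implicit Defensive.

Import Order.TTheory GRing.Theory Num.Theory.
Import numFieldNormedType.Exports.

Local Open Scope classical_set_scope.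

(** * Unordered sums *)

Section sums.
Local Open Scope complex_scope.
Local Open Scope ring_scope.
Context {R : realType} {G : choiceType}.
Implicit Types (p q : G -> R) (f : G -> R[i]).

Definition pos_summable p : Prop :=
  (forall g, 0 <= p g) /\ (\esum_(g in [set: G]) (p g)%:E < +oo)%E.

Definition psum p : R := fine (\esum_(g in [set: G]) (p g)%:E).

Lemma psumE p : pos_summable p ->
  (psum p)%:E = (\esum_(g in [set: G]) (p g)%:E)%E.
Proof.
move=> [p0 pfin]; rewrite fineK// ge0_fin_numE// esum_ge0// => g _.
by rewrite lee_fin.
Qed.

Lemma sum_le_psum p (F : {fset G}) : pos_summable p ->
  \sum_(g <- F) p g <= psum p.
Proof.
move=> ps; rewrite -lee_fin psumE//; apply: ereal_sup_ubound.
exists [set` F]; first by split => //; exact: finite_fset.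
by rewrite fsbig_finite//= set_fsetK sumEFin.
Qed.

(** The extended sum is a supremum over finite sets, so one bound on all finite partial sums yields
    finiteness and the estimate together. *)
Lemma psum_le p (M : R) : (forall g, 0 <= p g) ->
  (forall F : {fset G}, \sum_(g <- F) p g <= M) ->
  pos_summable p /\ psum p <= M.
Proof.
move=> p0 pM.
have le : (\esum_(g in [set: G]) (p g)%:E <= M%:E)%E.
  apply: ge_ereal_sup => _ [F [finF _] <-].
  by rewrite fsbig_finite//= sumEFin lee_fin.
have ps : pos_summable p by split=> //; apply: le_lt_trans le _; rewrite ltry.
by split=> //; rewrite -lee_fin psumE.
Qed.

Lemma psum_gt p (e : R) : pos_summable p -> 0 < e ->
  exists F : {fset G}, psum p - e < \sum_(g <- F) p g.
Proof.
move=> ps e0; apply: contrapT => nF.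
have [|_] := @psum_le p (psum p - e) (proj1 ps).
  by move=> F; rewrite leNgt; apply/negP => lt; apply: nF; exists F.
by rewrite lerBrDl gerDr leNgt e0.
Qed.

Lemma psum_ge0 p : pos_summable p -> 0 <= psum p.
Proof. by move=> ps; have := sum_le_psum fset0 ps; rewrite big_seq_fset0. Qed.

Lemma psumD p q : pos_summable p -> pos_summable q ->
  pos_summable (fun g => p g + q g) /\
  psum (fun g => p g + q g) = psum p + psum q.
Proof.
move=> sp sq; have [p0 pfin] := sp; have [q0 qfin] := sq.
have E : (\esum_(g in [set: G]) (p g + q g)%:E = (psum p + psum q)%:E)%E.
  rewrite EFinD !psumE// -esumD; first by apply: eq_esum => g _.
    by move=> g _; rewrite lee_fin.
  by move=> g _; rewrite lee_fin.
split; last by rewrite {1}/psum E.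
by split; [move=> g; rewrite addr_ge0 | rewrite E ltry].
Qed.

Lemma psumZ p (c : R) : 0 <= c -> pos_summable p ->
  pos_summable (fun g => c * p g) /\ psum (fun g => c * p g) = c * psum p.
Proof.
move=> c0 ps.
have [|F|scp le] := @psum_le (fun g => c * p g) (c * psum p).
- by move=> g; rewrite mulr_ge0 //; exact: (proj1 ps).
- by rewrite -mulr_sumr ler_wpM2l // sum_le_psum.
split=> //; apply/eqP; rewrite eq_le le/=.
have [c_gt0|c_le0] := ltP 0 c; last first.
  have cE : c = 0 by apply/eqP; rewrite eq_le c_le0 c0.
  by move: scp; rewrite cE mul0r; exact: psum_ge0.
rewrite mulrC -ler_pdivlMr//.
have [F|//] := @psum_le p (psum (fun g => c * p g) / c) (proj1 ps).
by rewrite ler_pdivlMr// mulrC mulr_sumr sum_le_psum.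
Qed.

Lemma psum0 : pos_summable (fun=> 0) /\ psum (fun=> 0) = 0.
Proof.
have [//|F|ps le] := @psum_le (fun=> 0) 0; first by rewrite big1.
by split=> //; apply/eqP; rewrite eq_le le psum_ge0.
Qed.

Lemma psum_single (g : G) (c : R) : 0 <= c ->
  pos_summable (fun h => if h == g then c else 0) /\
  psum (fun h => if h == g then c else 0) = c.
Proof.
move=> c0.
have E : (\esum_(h in [set: G]) (if h == g then c else 0)%:E)%E = c%:E.
  rewrite -[RHS](@esum_set1 R G g (fun=> c%:E)) ?lee_fin// [RHS]esum_mkcond.
  apply: eq_esum => h _; rewrite (_ : (h \in [set g]) = (h == g)).
    by case: ifP.
  by apply/idP/eqP => [|->]; rewrite in_setE.
split; last by rewrite {1}/psum E.
by split; [move=> h; case: ifP | rewrite E ltry].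
Qed.

(** [rsum] is defined through positive and negative parts; by [esumB] any other splitting into
    nonnegative summable families gives the same value. *)
Lemma rsum_psum p q : pos_summable p -> pos_summable q ->
  rsum (fun g => p g - q g) = psum p - psum q.
Proof.
move=> sp sq; have [p0 pfin] := sp; have [q0 qfin] := sq.
have := @esumB R G setT (EFin \o p) (EFin \o q).
rewrite /summable -/(psum p).
have a (r : G -> R) : (forall g, 0 <= r g) ->
    (\esum_(x in [set: G]) `|(EFin \o r) x| = \esum_(x in [set: G]) (r x)%:E)%E.
  by move=> r0; apply: eq_esum => g _; rewrite /= ger0_norm.
rewrite !a// => /(_ pfin qfin) B.
rewrite /rsum [X in fine X](_ : _ = (psum p - psum q)%:E)//.
rewrite EFinB !psumE// -B//; by move=> g _; rewrite lee_fin.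
Qed.

(* Splitting into nonnegative summable parts, not necessarily the positive and
   negative parts, makes linearity of [rsum] immediate. *)
Definition rsummable (f : G -> R) : Prop := exists p q,
  [/\ pos_summable p, pos_summable q & f = fun g => p g - q g].

Lemma rsum_lin (c : R) (f1 f2 : G -> R) : rsummable f1 -> rsummable f2 ->
  rsummable (fun g => c * f1 g + f2 g) /\
  rsum (fun g => c * f1 g + f2 g) = c * rsum f1 + rsum f2.
Proof.
move=> [p1 [q1 [sp1 sq1 ->]]] [p2 [q2 [sp2 sq2 ->]]].
rewrite (rsum_psum sp1 sq1) (rsum_psum sp2 sq2).
have [c0|c0] := leP 0 c.
- have [sp Ep] := psumZ c0 sp1; have [sq Eq] := psumZ c0 sq1.
  have [sp' Ep'] := psumD sp sp2; have [sq' Eq'] := psumD sq sq2.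
  have -> : (fun g => c * (p1 g - q1 g) + (p2 g - q2 g)) =
      (fun g => (c * p1 g + p2 g) - (c * q1 g + q2 g)).
    by apply/funext => g; ring.
  split; first by do 2 eexists; split; [exact: sp'|exact: sq'|].
  by rewrite rsum_psum// Ep' Eq' Ep Eq; ring.
(* For negative [c] the two parts exchange roles, so that both are multiplied by the nonnegative
   [- c]. *)
- have nc0 : 0 <= - c by rewrite oppr_ge0 ltW.
  have [sp Ep] := psumZ nc0 sp1; have [sq Eq] := psumZ nc0 sq1.
  have [sp' Ep'] := psumD sq sp2; have [sq' Eq'] := psumD sp sq2.
  have -> : (fun g => c * (p1 g - q1 g) + (p2 g - q2 g)) =
      (fun g => (- c * q1 g + p2 g) - (- c * p1 g + q2 g)).
    by apply/funext => g; ring.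
  split; first by do 2 eexists; split; [exact: sp'|exact: sq'|].
  by rewrite rsum_psum// Ep' Eq' Ep Eq; ring.
Qed.

Lemma rsum_pos p : pos_summable p -> rsummable p /\ rsum p = psum p.
Proof.
move=> ps; have [s0 E0] := psum0.
have pE : p = (fun g => p g - 0) by apply/funext => g; rewrite subr0.
split; first by exists p, (fun=> 0).
by rewrite pE (rsum_psum ps s0) E0 -pE subr0.
Qed.

Lemma rsum0 : rsummable (fun=> 0) /\ rsum (fun _ : G => 0) = 0 :> R.
Proof. by have [s0 E0] := psum0; have [rs ->] := rsum_pos s0. 
Qed.

Lemma rsum_single (g : G) (c : R) :
  rsummable (fun h => if h == g then c else 0) /\
  rsum (fun h => if h == g then c else 0) = c.
Proof.
wlog c0 : c / 0 <= c => [hw|].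
  have [/hw //|c0] := leP 0 c.
  have [|s E] := hw (- c); first by rewrite oppr_ge0 ltW.
  have [s0 E0] := rsum0; have := rsum_lin (-1) s s0; rewrite E E0.
  have -> : (fun h => -1 * (if h == g then - c else 0) + 0) =
      (fun h => if h == g then c else 0).
    by apply/funext => h; case: ifP => _; ring.
  by rewrite addr0 mulN1r opprK.
by have [s E] := psum_single g c0; have [rs ->] := rsum_pos s.
Qed.

Definition csummable f : Prop :=
  rsummable (fun g => complex.Re (f g)) /\ rsummable (fun g => complex.Im (f g)).

Lemma csum_lin (a : R[i]) f1 f2 : csummable f1 -> csummable f2 ->
  csummable (fun g => a * f1 g + f2 g) /\
  csum (fun g => a * f1 g + f2 g) = a * csum f1 + csum f2.
Proof.
case: a => a b [sr1 si1] [sr2 si2].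
have [s1 E1] := rsum_lin (- b) si1 sr2; have [s2 E2] := rsum_lin a sr1 s1.
have [s3 E3] := rsum_lin b sr1 si2; have [s4 E4] := rsum_lin a si1 s3.
rewrite /csummable /csum.
have -> : (fun g => complex.Re ((a +i* b) * f1 g + f2 g)) =
    (fun g => a * complex.Re (f1 g) + (- b * complex.Im (f1 g) + complex.Re (f2 g))).
  by apply/funext => g; case: (f1 g) (f2 g) => [? ?] [? ?] /=; ring.
have -> : (fun g => complex.Im ((a +i* b) * f1 g + f2 g)) =
    (fun g => a * complex.Im (f1 g) + (b * complex.Re (f1 g) + complex.Im (f2 g))).
  by apply/funext => g; case: (f1 g) (f2 g) => [? ?] [? ?] /=; ring.
split=> //; rewrite E2 E1 E4 E3; apply/eqP; rewrite eq_complex /=.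
by apply/andP; split; apply/eqP; ring.
Qed.

Lemma csum_conj f : csummable f ->
  csum (fun g => (f g)^*) = (csum f)^*.
Proof.
move=> [sr si]; have [s0 E0] := rsum0; have [_] := rsum_lin (-1) si s0.
rewrite E0 addr0 mulN1r => E; apply/eqP; rewrite eq_complex /= -E.
apply/andP; split; apply/eqP; congr rsum; apply/funext => g.
  by case: (f g).
by case: (f g) => ? ? /=; rewrite mulN1r addr0.
Qed.

Lemma csum_single (g : G) (c : R[i]) :
  csum (fun h => if h == g then c else 0) = c.
Proof.
case: c => a b; have [_ Ea] := rsum_single g a; have [_ Eb] := rsum_single g b.
rewrite -[in RHS]Ea -[in RHS]Eb /csum; congr (_ +i* _); congr rsum;
  by apply/funext => h; case: ifP.
Qed.

End sums.

(** * The Hilbert space structure of ell^2 *)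

Section inner_product.
Local Open Scope complex_scope.
Local Open Scope ring_scope.
Context {R : realType} {G : choiceType}.
Local Notation V := (ell2 R G).
Implicit Types (x y z : V) (a b c : R[i]).

Definition cabs a : R := Num.sqrt (sqmod a).

Lemma sqmod_eq0 a : sqmod a = 0 -> a = 0.
Proof.
case: a => s t /eqP; rewrite /sqmod /= paddr_eq0 ?sqr_ge0// !sqrf_eq0.
by move=> /andP[/eqP -> /eqP ->].
Qed.

Lemma sqmodC a : sqmod (a^*) = sqmod a.
Proof. by case: a => s t; rewrite /sqmod /= sqrrN. Qed.

Lemma sqmod0 : sqmod (0 : R[i]) = 0.
Proof. by rewrite /sqmod /= expr0n addr0. Qed.

Lemma sqmod1 : sqmod (1 : R[i]) = 1.
Proof. by rewrite /sqmod /= expr0n expr1n addr0. Qed.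

Lemma sqmodN a : sqmod (- a) = sqmod a.
Proof. by case: a => s t; rewrite /sqmod /= !sqrrN. Qed.

Lemma sqmod_real (s : R) : sqmod (s%:C) = s ^+ 2.
Proof. by rewrite /sqmod /= expr0n addr0. Qed.

Lemma mulr_conj a : a * a^* = (sqmod a)%:C.
Proof.
case: a => s t; apply/eqP; rewrite eq_complex /sqmod /=.
by apply/andP; split; apply/eqP; ring.
Qed.

Lemma conjcD a b : (a + b)^* = a^* + b^*. Proof. exact: rmorphD. Qed.
Lemma conjcM a b : (a * b)^* = a^* * b^*. Proof. exact: rmorphM. Qed.
Lemma conjcN a : (- a)^* = - a^*. Proof. exact: rmorphN. Qed.

Lemma cabs_ge0 a : 0 <= cabs a. Proof. exact: sqrtr_ge0. Qed.

Lemma cabs_sqr a : cabs a ^+ 2 = sqmod a.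
Proof. by rewrite sqr_sqrtr// sqmod_ge0. Qed.

Lemma cabs_real (s : R) : 0 <= s -> cabs (s%:C) = s.
Proof. by move=> s0; rewrite /cabs sqmod_real sqrtr_sqr ger0_norm. Qed.

Lemma Re_le_cabs a : complex.Re a <= cabs a.
Proof.
case: a => s t; apply: le_trans (ler_norm _) _ => /=.
by rewrite -sqrtr_sqr ler_wsqrtr// lerDl sqr_ge0.
Qed.

Lemma cabs_norm a : (cabs a)%:C = `|a|. Proof. by rewrite normc_def. Qed.

Lemma cabsB a b : cabs (a - b) <= cabs a + cabs b.
Proof. by rewrite -lecR rmorphD /= !cabs_norm ler_normB. Qed.

Lemma Re_dist_le a b : `|complex.Re a - complex.Re b| <= cabs (a - b).
Proof.
rewrite -sqrtr_sqr ler_wsqrtr// /sqmod.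
by case: a b => [s t] [s' t'] /=; rewrite lerDl sqr_ge0.
Qed.

Lemma Im_dist_le a b : `|complex.Im a - complex.Im b| <= cabs (a - b).
Proof.
rewrite -sqrtr_sqr ler_wsqrtr// /sqmod.
by case: a b => [s t] [s' t'] /=; rewrite lerDr sqr_ge0.
Qed.

Lemma cabs_small a : (forall e : R, 0 < e -> cabs a <= e) -> a = 0.
Proof.
move=> small; apply: sqmod_eq0; rewrite -cabs_sqr.
suff -> : cabs a = 0 by rewrite expr0n.
apply/eqP; rewrite eq_le cabs_ge0 andbT.
by apply/ler_addgt0Pr => e e0; rewrite add0r small.
Qed.

Lemma ell2_inj x y : (forall g, x g = y g) -> x = y.
Proof. by move=> xy; apply: val_inj; apply/funext. Qed.

Lemma ell2D x y g : (x + y) g = x g + y g. Proof. by []. Qed.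
Lemma ell2Z a x g : (a *: x) g = a * x g. Proof. by []. Qed.
Lemma ell2N x g : (- x) g = - x g. Proof. by []. Qed.
Lemma ell20 g : (0 : V) g = 0. Proof. by []. Qed.
Lemma ell2B x y g : (x - y) g = x g - y g. Proof. by []. Qed.

Definition ell2E := (ell2D, ell2B, ell2N, ell2Z, ell20).

Lemma ell2_pos_summable x : pos_summable (fun g => sqmod (x g)).
Proof.
by split=> [g|]; [exact: sqmod_ge0 | have /asboolP := ell2_valP x].
Qed.

Lemma pos_summable_ell2 (f : G -> R[i]) :
  pos_summable (fun g => sqmod (f g)) -> f \in square_summable.
Proof. by move=> [_ ffin]; apply/asboolP. Qed.

Definition nsq x : R := psum (fun g => sqmod (x g)).

Lemma nsq_ge0 x : 0 <= nsq x.
Proof. exact: psum_ge0 (ell2_pos_summable x). Qed.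

Lemma l2norm_ge0 x : 0 <= l2norm x. Proof. exact: sqrtr_ge0. Qed.

Lemma l2normE x : l2norm x = Num.sqrt (nsq x). Proof. by []. Qed.

Lemma l2norm_sqr x : l2norm x ^+ 2 = nsq x.
Proof. by rewrite sqr_sqrtr// nsq_ge0. Qed.

Lemma sum_le_nsq x (F : {fset G}) : \sum_(g <- F) sqmod (x g) <= nsq x.
Proof. exact: sum_le_psum (ell2_pos_summable x). Qed.

Lemma coord_le_nsq x g : sqmod (x g) <= nsq x.
Proof. by have := sum_le_nsq x [fset g]%fset; rewrite big_seq_fset1. Qed.

Lemma coord_le_l2norm x g : cabs (x g) <= l2norm x.
Proof. by apply: ler_wsqrtr; exact: coord_le_nsq. Qed.

Lemma nsq_eq0 x : nsq x = 0 -> x = 0.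
Proof.
move=> x0; apply: ell2_inj => g; rewrite ell20; apply: sqmod_eq0.
by apply/eqP; rewrite eq_le sqmod_ge0 andbT -x0 coord_le_nsq.
Qed.

(** Polarization: the real part of each term is a quarter of the difference of the square moduli of
    [x + y] and [x - y], and the imaginary part likewise with ['i *: y] for [y]. *)
Lemma inner_csummable x y : csummable (fun g => x g * (y g)^*).
Proof.
have h0 : (0 : R) <= 4^-1 by rewrite invr_ge0.
have sq z := proj1 (psumZ h0 (ell2_pos_summable z)).
split.
  exists (fun g => 4^-1 * sqmod ((x + y) g)), (fun g => 4^-1 * sqmod ((x - y) g)).
  split=> //; apply/funext => g; rewrite !ell2E.
  by case: (x g) (y g) => [s t] [u v]; rewrite /sqmod /=; field.
exists (fun g => 4^-1 * sqmod ((x + 'i%C *: y) g)),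
  (fun g => 4^-1 * sqmod ((x - 'i%C *: y) g)).
split=> //; apply/funext => g; rewrite !ell2E.
by case: (x g) (y g) => [s t] [u v]; rewrite /sqmod /=; field.
Qed.

Lemma inner_linl a x y z : inner (a *: x + y) z = a * inner x z + inner y z.
Proof.
have [_ E] := csum_lin a (inner_csummable x z) (inner_csummable y z).
by rewrite /inner -E; congr csum; apply/funext => g; rewrite !ell2E mulrDl mulrA.
Qed.

Lemma inner_conj x y : inner y x = (inner x y)^*.
Proof.
rewrite /inner -(csum_conj (inner_csummable x y)); congr csum.
by apply/funext => g; rewrite conjcM conjCK mulrC.
Qed.

Lemma innerDl x y z : inner (x + y) z = inner x z + inner y z.
Proof. by have := inner_linl 1 x y z; rewrite scale1r mul1r. Qed.

Lemma inner0l z : inner 0 z = 0.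
Proof.
have /eqP := innerDl 0 0 z.
by rewrite addr0 -[X in X == _]addr0 (inj_eq (addrI _)) => /eqP <-.
Qed.

Lemma innerZl a x z : inner (a *: x) z = a * inner x z.
Proof. by have := inner_linl a x 0 z; rewrite inner0l !addr0. Qed.

Lemma innerNl x z : inner (- x) z = - inner x z.
Proof. by rewrite -scaleN1r innerZl mulN1r. Qed.

Lemma innerBl x y z : inner (x - y) z = inner x z - inner y z.
Proof. by rewrite innerDl innerNl. Qed.

Lemma innerDr x y z : inner z (x + y) = inner z x + inner z y.
Proof. by rewrite inner_conj innerDl conjcD -!inner_conj. Qed.

Lemma inner0r z : inner z 0 = 0.
Proof. by rewrite inner_conj inner0l conjC0. Qed.

Lemma innerZr a x z : inner z (a *: x) = a^* * inner z x.
Proof. by rewrite inner_conj innerZl conjcM -inner_conj. Qed.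

Lemma innerNr x z : inner z (- x) = - inner z x.
Proof. by rewrite inner_conj innerNl conjcN -inner_conj. Qed.

Lemma innerBr x y z : inner z (x - y) = inner z x - inner z y.
Proof. by rewrite innerDr innerNr. Qed.

Lemma inner_xx x : inner x x = (nsq x)%:C.
Proof.
have [s0 E0] := @rsum0 R G; have [_ E] := rsum_pos (ell2_pos_summable x).
rewrite /nsq -E /inner /csum.
have -> : (fun g => complex.Re (x g * (x g)^*)) = (fun g => sqmod (x g)).
  by apply/funext => g; rewrite mulr_conj.
have -> : (fun g => complex.Im (x g * (x g)^*)) = (fun=> 0).
  by apply/funext => g; rewrite mulr_conj.
by rewrite E0.
Qed.

Lemma nsqE x : nsq x = complex.Re (inner x x). Proof. by rewrite inner_xx. Qed.

Lemma nsqDZ x a y :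
  nsq (x + a *: y) = nsq x + 2 * complex.Re (a^* * inner x y) + sqmod a * nsq y.
Proof.
rewrite !nsqE !(innerDl, innerDr) !(innerZl, innerZr) (inner_conj x y) !inner_xx.
by case: (inner x y) a => [s t] [u v]; rewrite /sqmod /=; ring.
Qed.

Lemma nsqD x y : nsq (x + y) = nsq x + 2 * complex.Re (inner x y) + nsq y.
Proof. by rewrite -{1}[y]scale1r nsqDZ sqmod1 conjC1 !mul1r. Qed.

Lemma nsqN x : nsq (- x) = nsq x.
Proof. by rewrite !nsqE innerNl innerNr opprK. Qed.

Lemma nsqZ a x : nsq (a *: x) = sqmod a * nsq x.
Proof.
have := nsqDZ 0 a x; rewrite add0r inner0l mulr0 /= mulr0 addr0 => ->.
by rewrite nsqE inner0l add0r.
Qed.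

Lemma nsqB x y : nsq (x - y) = nsq x - 2 * complex.Re (inner x y) + nsq y.
Proof. by rewrite nsqD innerNr nsqN; case: (inner x y) => s t /=; ring. Qed.

Lemma parallelogram x y : nsq (x - y) + nsq (x + y) = 2 * nsq x + 2 * nsq y.
Proof. by rewrite nsqB nsqD; ring. Qed.

Lemma l2normZ a x : l2norm (a *: x) = cabs a * l2norm x.
Proof.
by rewrite !l2normE nsqZ sqrtrM ?sqmod_ge0.
Qed.

Lemma l2normN x : l2norm (- x) = l2norm x.
Proof. by rewrite !l2normE nsqN. Qed.

Lemma l2norm0 : l2norm (0 : V) = 0.
Proof. by rewrite -(scale0r (0 : V)) l2normZ /cabs sqmod0 sqrtr0 mul0r. Qed.

Lemma l2norm_eq0 x : l2norm x = 0 -> x = 0.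
Proof. by move=> x0; apply: nsq_eq0; rewrite -l2norm_sqr x0 expr0n. Qed.

Lemma cauchy_schwarz_sqr x y : sqmod (inner x y) <= nsq x * nsq y.
Proof.
have [y0|y0] := eqVneq (nsq y) 0.
  by rewrite (nsq_eq0 y0) inner_conj inner0l conjC0 sqmod0 mulr_ge0 ?nsq_ge0.
have yp : 0 < nsq y by rewrite lt_def y0 nsq_ge0.
(* The vector is [x] minus its orthogonal projection onto the line of [y]; its squared norm is
   [nsq x - sqmod (inner x y) / nsq y]. *)
have := nsq_ge0 (x + (- inner x y * (nsq y)^-1%:C) *: y).
rewrite nsqDZ sqmodM sqmodN sqmod_real.
have -> : complex.Re ((- inner x y * (nsq y)^-1%:C)^* * inner x y) =
    - sqmod (inner x y) / nsq y.
  by case: (inner x y) => s t; rewrite /sqmod /=; ring.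
set s := sqmod _.
have -> : nsq x + 2 * (- s / nsq y) + s * (nsq y)^-1 ^+ 2 * nsq y =
    nsq x - s / nsq y by field.
by rewrite subr_ge0 ler_pdivrMr.
Qed.

Lemma cauchy_schwarz x y : cabs (inner x y) <= l2norm x * l2norm y.
Proof.
rewrite -(@ler_pXn2r _ 2)// ?nnegrE ?mulr_ge0 ?l2norm_ge0 ?cabs_ge0//.
by rewrite exprMn !l2norm_sqr cabs_sqr cauchy_schwarz_sqr.
Qed.

Lemma l2normD x y : l2norm (x + y) <= l2norm x + l2norm y.
Proof.
rewrite -(@ler_pXn2r _ 2)// ?nnegrE ?addr_ge0 ?l2norm_ge0//.
rewrite sqrrD !l2norm_sqr nsqD lerD2r lerD2l -[leRHS]mulr_natl ler_wpM2l//.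
exact: le_trans (Re_le_cabs _) (cauchy_schwarz _ _).
Qed.

Lemma l2normB x y : l2norm (x - y) <= l2norm x + l2norm y.
Proof. by rewrite -(l2normN y) l2normD. Qed.

Lemma l2norm_dist x y z : l2norm (x - z) <= l2norm (x - y) + l2norm (y - z).
Proof. by rewrite -(subrKA y) l2normD. Qed.

Lemma l2norm_small x : (forall e : R, 0 < e -> l2norm x <= e) -> x = 0.
Proof.
move=> small; apply: l2norm_eq0; apply/eqP; rewrite eq_le l2norm_ge0 andbT.
by apply/ler_addgt0Pr => e e0; rewrite add0r small.
Qed.

Lemma inner_inj x y : (forall z, inner x z = inner y z) -> x = y.
Proof.
move=> xy; apply/eqP; rewrite -subr_eq0; apply/eqP/nsq_eq0.
by rewrite nsqE innerBl xy subrr.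
Qed.

Lemma delta_pos_summable (g : G) :
  pos_summable (fun h => sqmod (if h == g then 1 else 0 : R[i])).
Proof.
have [s _] := psum_single g (ler01 : 0 <= (1 : R)).
have -> : (fun h => sqmod (if h == g then 1 else 0 : R[i])) =
    (fun h => if h == g then 1 else 0) => //.
by apply/funext => h; case: ifP => _; rewrite ?sqmod1 ?sqmod0.
Qed.

Definition delta (g : G) : V := Ell2 (pos_summable_ell2 (delta_pos_summable g)).

Lemma deltaE g h : delta g h = if h == g then 1 else 0. Proof. by []. Qed.

Lemma inner_delta x g : inner x (delta g) = x g.
Proof.
rewrite -[RHS](csum_single g); congr csum; apply/funext => h.
by rewrite deltaE; case: eqP => [->|_]; rewrite ?conjC1 ?mulr1// conjC0 mulr0.
Qed.

Lemma nsq_delta g : nsq (delta g) = 1.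
Proof. by rewrite nsqE inner_delta deltaE eqxx. Qed.

End inner_product.

(** * Density of finitely supported vectors, Riesz representation and completeness *)

Section completeness.
Local Open Scope complex_scope.
Local Open Scope ring_scope.
Context {R : realType} {G : choiceType}.
Local Notation V := (ell2 R G).
Implicit Types (x y z : V) (a b c : R[i]) (F : {fset G}).

Definition trunc x F : V := \sum_(g <- F) x g *: delta g.

Lemma inner_sumr x (f : G -> R[i]) F :
  inner x (\sum_(g <- F) f g *: delta g) = \sum_(g <- F) (f g)^* * x g.
Proof.
rewrite (big_morph (inner x) (fun s t => innerDr s t x) (inner0r x)).
by apply: eq_bigr => g _; rewrite innerZr inner_delta.
Qed.

Lemma sum_delta (f : G -> R[i]) F h :
  (\sum_(g <- F) f g *: delta g : V) h = if h \in F then f h else 0.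
Proof.
transitivity (\sum_(g <- F) if g == h then f h else 0).
  rewrite (big_morph (fun z : V => z h) (fun s t => ell2D s t h) (ell20 h)).
  apply: eq_bigr => g _.
  by rewrite ell2Z deltaE eq_sym; case: eqP => [->|_]; rewrite ?mulr1 ?mulr0.
case: ifPn => hF; last first.
  rewrite big_seq big1 // => g gF; case: eqP => // gh.
  by move: hF; rewrite -gh gF.
by rewrite (big_fsetD1 h)//= eqxx big_seq big1 ?addr0// => g; rewrite !inE;
  case: eqP.
Qed.

Lemma nsq_sum_delta (f : G -> R[i]) F :
  nsq (\sum_(g <- F) f g *: delta g : V) = \sum_(g <- F) sqmod (f g).
Proof.
rewrite nsqE inner_sumr (_ : \sum_(g <- F) _ = (\sum_(g <- F) sqmod (f g))%:C)//.
rewrite rmorph_sum big_seq [RHS]big_seq; apply: eq_bigr => g gF.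
by rewrite sum_delta gF mulrC mulr_conj.
Qed.

(** Pythagoras: [trunc x F] is the orthogonal projection of [x] onto the coordinates in [F]. *)
Lemma nsq_sub_trunc x F :
  nsq (x - trunc x F) = nsq x - \sum_(g <- F) sqmod (x g).
Proof.
rewrite nsqB nsq_sum_delta inner_sumr.
rewrite (_ : \sum_(g <- F) (x g)^* * _ = (\sum_(g <- F) sqmod (x g))%:C) /=.
  by ring.
by rewrite rmorph_sum; apply: eq_bigr => g _; rewrite mulrC mulr_conj.
Qed.

Lemma trunc_approx x (e : R) : 0 < e -> exists F, l2norm (x - trunc x F) <= e.
Proof.
move=> e0; have e20 : 0 < e ^+ 2 by rewrite exprn_gt0.
have [F lt] := psum_gt (ell2_pos_summable x) e20; exists F.
rewrite -(@ler_pXn2r _ 2)// ?nnegrE ?l2norm_ge0 ?ltW//.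
by rewrite l2norm_sqr nsq_sub_trunc; move: lt; rewrite -/(nsq x) => lt; lra.
Qed.

Lemma scalar_sum (f : V -> R[i]) (u : G -> R[i]) F : scalar f ->
  f (\sum_(g <- F) u g *: delta g) = \sum_(g <- F) u g * f (delta g).
Proof.
move=> fl.
have f0 : f 0 = 0.
  have /eqP := fl 1 0 0; rewrite scale1r addr0 mul1r.
  by rewrite -[X in X == _]addr0 (inj_eq (addrI _)) => /eqP <-.
have fD s t : f (s + t) = f s + f t.
  by have := fl 1 s t; rewrite scale1r mul1r.
rewrite (big_morph f fD f0); apply: eq_bigr => g _.
by have := fl (u g) (delta g) 0; rewrite f0 !addr0.
Qed.

Lemma scalar_eq0 (f : V -> R[i]) (M : R) : scalar f ->
  (forall x, cabs (f x) <= M * l2norm x) -> (forall g, f (delta g) = 0) ->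
  forall x, f x = 0.
Proof.
move=> fl fM f0 x; apply: cabs_small => e e0.
(* [M] may be zero or negative; a positive upper bound is needed as a divisor. *)
pose M' := `|M| + 1; have M'0 : 0 < M' by rewrite ltr_wpDl.
have [F le] := trunc_approx x (divr_gt0 e0 M'0).
have -> : f x = f (x - trunc x F).
  have := fl 1 (x - trunc x F) (trunc x F).
  rewrite scale1r subrK mul1r [f (trunc _ _)](scalar_sum _ _ fl) => ->.
  by rewrite big1 ?addr0// => g _; rewrite f0 mulr0.
apply: (le_trans (fM _)); apply: (@le_trans _ _ (M' * (e / M'))); last first.
  by rewrite mulrC divfK// gt_eqF.
apply: (@le_trans _ _ (M' * l2norm (x - trunc x F))).
  rewrite ler_wpM2r ?l2norm_ge0// /M'; apply: le_trans (ler_norm M) _.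
  by rewrite lerDl.
by rewrite ler_wpM2l// ltW.
Qed.

(** The coordinates of the representing vector must be the conjugates of [f (delta g)]. If [s] is
    the squared norm of a finite truncation, the bound on [f] there reads [s <= M * Num.sqrt s],
    hence [s <= M ^+ 2]; this gives square summability, and density does the rest. *)
Lemma riesz (f : V -> R[i]) (M : R) : scalar f ->
  (forall x, cabs (f x) <= M * l2norm x) ->
  exists v : V, forall x, f x = inner x v.
Proof.
move=> fl fM; pose v g := (f (delta g))^*.
have vs : pos_summable (fun g => sqmod (v g)).
  have [||//] := @psum_le R G (fun g => sqmod (v g)) (M ^+ 2).
    by move=> g; exact: sqmod_ge0.
  move=> F; set s := \sum_(g <- F) _.
  have s0 : 0 <= s by apply: sumr_ge0 => g _; exact: sqmod_ge0.
  have := fM (\sum_(g <- F) v g *: delta g).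
  rewrite scalar_sum// l2normE nsq_sum_delta.
  have -> : \sum_(g <- F) v g * f (delta g) = s%:C.
    rewrite rmorph_sum; apply: eq_bigr => g _.
    by rewrite mulrC mulr_conj sqmodC.
  rewrite cabs_real// -/s; have := sqrtr_ge0 s; have := sqr_sqrtr s0.
  move: (Num.sqrt s) => t <- t0.
  have [->|tn0] := eqVneq t 0; first by rewrite expr0n/= sqr_ge0.
  have tp : 0 < t by rewrite lt_def tn0.
  rewrite [leLHS]expr2 ler_pM2r// => tM.
  by rewrite ler_pXn2r// nnegrE// (le_trans t0 tM).
pose w : V := Ell2 (pos_summable_ell2 vs); exists w => x.
apply/eqP; rewrite -subr_eq0; apply/eqP.
apply: (@scalar_eq0 (fun x => f x - inner x w) (`|M| + l2norm w)).
- by move=> a s t /=; rewrite fl inner_linl; ring.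
- move=> s; rewrite mulrDl.
  apply: (le_trans (cabsB _ _)); apply: lerD; last first.
    by rewrite mulrC cauchy_schwarz.
  apply: (le_trans (fM _)); rewrite ler_wpM2r ?l2norm_ge0//; exact: ler_norm.
- by move=> g; rewrite inner_conj inner_delta /= conjCK subrr.
Qed.

Lemma real_cauchy_cvg (r : nat -> R) :
  (forall e : R, 0 < e -> exists N : nat, forall m n,
     (N <= m)%N -> (N <= n)%N -> `|r m - r n| <= e) ->
  exists l : R, r @ \oo --> l.
Proof.
move=> rC; suff : cvg (r @ \oo) by move=> rcv; exists (lim (r @ \oo)).
apply: (@cauchy_cvg R^o); apply: cauchy_exP => e e0.
have [N NP] := rC (e / 2) (divr_gt0 e0 (ltr0Sn _ 1)).
exists (r N), N => // n /= Nn.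
rewrite /ball /=; apply: le_lt_trans (NP _ _ (leqnn N) Nn) _.
by rewrite ltr_pdivrMr// ltr_pMr// ltr1n.
Qed.

(** The limit is formed coordinatewise. The conclusion carries each Cauchy estimate over to the
    limit with the same constant and the same index, which later gives rates of convergence that are
    uniform in the vector. *)
Lemma ell2_complete (u : nat -> V) :
  (forall e : R, 0 < e -> exists N : nat, forall m n,
     (N <= m)%N -> (N <= n)%N -> l2norm (u m - u n) <= e) ->
  exists l : V, forall (e : R) N, 0 <= e ->
    (forall m n, (N <= m)%N -> (N <= n)%N -> l2norm (u m - u n) <= e) ->
    forall n, (N <= n)%N -> l2norm (u n - l) <= e.
Proof.
move=> uC.
have lre g : exists l : R, (fun n => complex.Re (u n g)) @ \oo --> l.
  apply: real_cauchy_cvg => e e0; have [N NP] := uC e e0; exists N => m n Nm Nn.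
  apply: le_trans (le_trans (coord_le_l2norm _ g) (NP m n Nm Nn)).
  by rewrite ell2E; exact: Re_dist_le.
have lim_ g : exists l : R, (fun n => complex.Im (u n g)) @ \oo --> l.
  apply: real_cauchy_cvg => e e0; have [N NP] := uC e e0; exists N => m n Nm Nn.
  apply: le_trans (le_trans (coord_le_l2norm _ g) (NP m n Nm Nn)).
  by rewrite ell2E; exact: Im_dist_le.
have [lr lrP] := choice lre; have [li liP] := choice lim_.
pose l g := lr g +i* li g.
(* On finitely many coordinates the estimate passes to the limit in [m], before [l] is known to be
   near any vector of the space. *)
have fin (e : R) N n F : (forall m, (N <= m)%N -> l2norm (u n - u m) <= e) ->
    \sum_(g <- F) sqmod (u n g - l g) <= e ^+ 2.
  move=> NP.
  have cv : (fun m => \sum_(g <- F) sqmod (u n g - u m g)) @ \oo -->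
      \sum_(g <- F) sqmod (u n g - l g).
    elim: (enum_fset F) => [|g r IH].
      rewrite big_nil; under eq_fun do rewrite big_nil.
      exact: cvg_cst.
    rewrite big_cons; under eq_fun do rewrite big_cons.
    apply: cvgD IH; rewrite /sqmod.
    have E m : complex.Re (u n g - u m g) ^+ 2 + complex.Im (u n g - u m g) ^+ 2
        = (complex.Re (u n g) - complex.Re (u m g)) ^+ 2 +
          (complex.Im (u n g) - complex.Im (u m g)) ^+ 2.
      by case: (u n g) (u m g) => [? ?] [? ?].
    under eq_fun do rewrite E.
    have -> : complex.Re (u n g - l g) ^+ 2 + complex.Im (u n g - l g) ^+ 2
        = (complex.Re (u n g) - lr g) ^+ 2 + (complex.Im (u n g) - li g) ^+ 2.
      by rewrite /l; case: (u n g).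
    rewrite !expr2; under eq_fun do rewrite !expr2.
    have c1 : (fun m => complex.Re (u n g) - complex.Re (u m g)) @ \oo -->
        complex.Re (u n g) - lr g.
      by apply: cvgB; [exact: cvg_cst | exact: lrP].
    have c2 : (fun m => complex.Im (u n g) - complex.Im (u m g)) @ \oo -->
        complex.Im (u n g) - li g.
      by apply: cvgB; [exact: cvg_cst | exact: liP].
    by apply: cvgD; apply: cvgM.
  rewrite -(cvg_lim (@Rhausdorff R) cv); apply: limr_le; first by apply: cvgP cv.
  exists N => // m /= Nm.
  apply: (@le_trans _ _ (nsq (u n - u m))).
    exact: (sum_le_nsq (u n - u m)).
  have e0 := le_trans (l2norm_ge0 _) (NP m Nm).
  by rewrite -l2norm_sqr ler_pXn2r// ?nnegrE ?l2norm_ge0// NP.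
have [N NP] := uC 1 ltr01.
have [|F|ds _] := @psum_le R G (fun g => sqmod (u N g - l g)) (1 ^+ 2).
- by move=> g; exact: sqmod_ge0.
- by apply: (@fin 1 N N F) => m Nm; exact: NP.
(* What has been shown square summable is the difference [u N - l], so the limit is represented as
   [u N - d]. *)
pose d : V := Ell2 (pos_summable_ell2 ds); exists (u N - d) => e N' e0 NP' n Nn.
rewrite -(@ler_pXn2r _ 2)// ?nnegrE ?l2norm_ge0 // l2norm_sqr.
have [|F|_ le] := @psum_le R G (fun g => sqmod ((u n - (u N - d)) g)) (e ^+ 2).
- by move=> g; exact: sqmod_ge0.
- have -> : \sum_(g <- F) sqmod ((u n - (u N - d)) g) =
      \sum_(g <- F) sqmod (u n g - l g).
    by apply: eq_bigr => g _; rewrite !ell2E /d /= subKr.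
  by apply: (fin e N' n F) => m N'm; exact: NP'.
- exact: le.
Qed.

End completeness.

(** * Bounded operators and commutants *)

Section bounded_operators.
Local Open Scope complex_scope.
Local Open Scope ring_scope.
Context {R : realType} {G : choiceType}.
Local Notation V := (ell2 R G).
Implicit Types (x y z : V) (a b c : R[i]) (S T U W : V -> V).

Lemma fun_linE a S T x : (a *: S + T) x = a *: S x + T x. Proof. by []. Qed.
Lemma lin0 T : linear T -> T 0 = 0.
Proof.
move=> lT; have /eqP := lT 1 0 0; rewrite !scale1r addr0.
by rewrite -[X in X == _]addr0 (inj_eq (addrI _)) => /eqP <-.
Qed.

Lemma linD T x y : linear T -> T (x + y) = T x + T y.
Proof. by move=> lT; have := lT 1 x y; rewrite !scale1r. Qed.

Lemma linZ T a x : linear T -> T (a *: x) = a *: T x.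
Proof. by move=> lT; have := lT a x 0; rewrite (lin0 lT) !addr0. Qed.

Lemma linN T x : linear T -> T (- x) = - T x.
Proof. by move=> lT; rewrite -scaleN1r linZ// scaleN1r. Qed.

Lemma linB T x y : linear T -> T (x - y) = T x - T y.
Proof. by move=> lT; rewrite linD// linN. Qed.

Lemma bounded_operatorP T : bounded_operator T ->
  exists2 M : R, 0 < M & forall x, l2norm (T x) <= M * l2norm x.
Proof.
move=> [lT [M MP]]; exists (`|M| + 1); first by rewrite ltr_wpDl.
move=> x; apply: (le_trans (MP x)); rewrite ler_wpM2r ?l2norm_ge0//.
by apply: le_trans (ler_norm M) _; rewrite lerDl.
Qed.

Lemma bounded_id : bounded_operator (idfun : V -> V).
Proof. by split=> //; exists 1 => x; rewrite mul1r. Qed.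

Lemma bounded_lin a S T : bounded_operator S -> bounded_operator T ->
  bounded_operator (a *: S + T).
Proof.
move=> bS bT; have [M M0 MP] := bounded_operatorP bS.
have [N N0 NP] := bounded_operatorP bT.
have [lS _] := bS; have [lT _] := bT; split.
  move=> b x y; rewrite !fun_linE lS lT scalerDr scalerA mulrC -scalerA.
  by rewrite scalerDr !addrA; congr (_ + _); rewrite addrAC.
exists (cabs a * M + N) => x; rewrite fun_linE.
apply: (le_trans (l2normD _ _)); rewrite mulrDl lerD// l2normZ -mulrA.
by rewrite ler_wpM2l ?cabs_ge0.
Qed.

Lemma bounded0 : bounded_operator (0 : V -> V).
Proof.
split; first by move=> a x y; rewrite /= [RHS](_ : _ = a *: 0 + 0)// scaler0 addr0.
by exists 0 => x; rewrite mul0r (_ : (0 : V -> V) x = 0)// l2norm0.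
Qed.

Lemma bounded_scale a T : bounded_operator T -> bounded_operator (a *: T).
Proof. by move=> bT; rewrite -[_ *: _]addr0; apply: bounded_lin bounded0. Qed.

Lemma bounded_sub S T : bounded_operator S -> bounded_operator T ->
  bounded_operator (S - T).
Proof. by move=> bS bT; rewrite addrC -scaleN1r; exact: bounded_lin. Qed.

Lemma bounded_comp S T : bounded_operator S -> bounded_operator T ->
  bounded_operator (S \o T).
Proof.
move=> bS bT; have [M M0 MP] := bounded_operatorP bS.
have [N N0 NP] := bounded_operatorP bT.
have [lS _] := bS; have [lT _] := bT; split.
  by move=> a x y; rewrite /= lT lS.
exists (M * N) => x /=; apply: (le_trans (MP _)).
by rewrite -mulrA ler_wpM2l// ltW.
Qed.

(** The [sup] in [opnorm] is meaningful because a bounded operator is bounded on the unit ball; the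
    estimate follows by normalizing [x]. *)
Lemma opnorm_ub T x : bounded_operator T ->
  l2norm (T x) <= opnorm T * l2norm x.
Proof.
move=> bT; have [M M0 MP] := bounded_operatorP bT; have [lT _] := bT.
have ub : has_sup [set l2norm (T x) | x in [set x : V | l2norm x <= 1]].
  split; first by exists (l2norm (T 0)), 0 => //=; rewrite l2norm0.
  exists M => _ [y /= y1 <-]; apply: (le_trans (MP y)).
  by rewrite -[leRHS]mulr1 ler_wpM2l// ltW.
have [/l2norm_eq0 ->|x0] := eqVneq (l2norm x) 0.
  by rewrite lin0// l2norm0 mulr0.
have xp : 0 < l2norm x by rewrite lt_def x0 l2norm_ge0.
rewrite -ler_pdivrMr//.
have inv0 : 0 <= (l2norm x)^-1 by rewrite invr_ge0 ltW.
have -> : l2norm (T x) / l2norm x = l2norm (T ((l2norm x)^-1%:C *: x)).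
  by rewrite linZ// l2normZ cabs_real// mulrC.
apply: sup_upper_bound => //; exists ((l2norm x)^-1%:C *: x) => //=.
by rewrite l2normZ cabs_real// mulVf.
Qed.

Lemma opnorm_le T (M : R) : linear T -> 0 <= M ->
  (forall x, l2norm (T x) <= M * l2norm x) -> opnorm T <= M.
Proof.
move=> lT M0 MP; apply: ge_sup.
  by exists (l2norm (T 0)), 0 => //=; rewrite l2norm0.
move=> _ [y /= y1 <-]; apply: (le_trans (MP y)).
by rewrite -[leRHS]mulr1 ler_wpM2l.
Qed.

Lemma opnorm_lt_dist U S (e : R) x : bounded_operator U -> bounded_operator S ->
  opnorm (U - S) < e -> l2norm (U x - S x) <= e * l2norm x.
Proof.
move=> bU bS lt; apply: le_trans (opnorm_ub x (bounded_sub bU bS)) _.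
by rewrite ler_wpM2r ?l2norm_ge0 ?ltW.
Qed.

Lemma bounded_eq_on_delta S T : bounded_operator S -> bounded_operator T ->
  (forall g, S (delta g) = T (delta g)) -> S = T.
Proof.
move=> bS bT ST; apply/funext => x; apply/eqP; rewrite -subr_eq0; apply/eqP.
have bU := bounded_sub bS bT; have [[lS _] [lT _]] := (bS, bT).
have [M M0 MP] := bounded_operatorP bU.
apply: ell2_inj => h; rewrite ell20.
apply: (@scalar_eq0 _ _ (fun x => (S x - T x) h) M).
- by move=> a y z; rewrite lS lT !ell2E; ring.
- by move=> y; apply: le_trans (coord_le_l2norm _ _) (MP y).
- by move=> g; rewrite ST subrr.
Qed.

Lemma is_adjoint_sym S T : is_adjoint T S -> is_adjoint S T.
Proof. by move=> TS x y; rewrite inner_conj -TS -inner_conj. Qed.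

Lemma is_adjoint_uniq S S' T : is_adjoint T S -> is_adjoint T S' -> S = S'.
Proof.
move=> /is_adjoint_sym TS /is_adjoint_sym TS'; apply/funext => x.
by apply: inner_inj => z; rewrite TS TS'.
Qed.

Lemma adjoint_bounded S T : bounded_operator T -> is_adjoint T S ->
  bounded_operator S.
Proof.
move=> bT TS; have ST := is_adjoint_sym TS.
have [M M0 MP] := bounded_operatorP bT; split.
  move=> a x y; apply: inner_inj => z.
  by rewrite inner_linl !ST inner_linl.
exists M => y; have [->|Sy0] := eqVneq (l2norm (S y)) 0.
  by rewrite mulr_ge0 ?l2norm_ge0 ?ltW.
have Syp : 0 < l2norm (S y) by rewrite lt_def Sy0 l2norm_ge0.
(* Multiplied by the norm of [S y], the claim becomes a bound on [inner (T (S y)) y], which is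
   Cauchy-Schwarz. *)
rewrite -(ler_pM2l Syp) -expr2 l2norm_sqr nsqE -TS.
apply: (le_trans (Re_le_cabs _)); apply: (le_trans (cauchy_schwarz _ _)).
by rewrite mulrA ler_wpM2r ?l2norm_ge0// mulrC MP.
Qed.

(** Riesz representation of [x |-> inner (T x) y], one [y] at a time; linearity and boundedness then
    follow from the adjoint relation. *)
Lemma adjoint_exists T : bounded_operator T ->
  exists2 S, bounded_operator S & is_adjoint T S.
Proof.
move=> bT; have [M M0 MP] := bounded_operatorP bT; have [lT _] := bT.
have /choice[S SP] : forall y, exists v : V, forall x, inner (T x) y = inner x v.
  move=> y; apply: (@riesz _ _ (fun x => inner (T x) y) (M * l2norm y)).
    by move=> a s t /=; rewrite lT inner_linl.
  move=> x; apply: (le_trans (cauchy_schwarz _ _)).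
  by rewrite mulrAC ler_wpM2r ?l2norm_ge0.
have TS : is_adjoint T S by move=> x y; exact: SP.
by exists S => //; exact: adjoint_bounded TS.
Qed.

Lemma is_adjoint_comp S S' T T' : is_adjoint S S' -> is_adjoint T T' ->
  is_adjoint (S \o T) (T' \o S').
Proof. by move=> SS TT x y /=; rewrite SS TT. Qed.

Lemma dist_le_small x (c : R) :
  (forall e : R, 0 < e -> l2norm x <= e * c) -> x = 0.
Proof.
move=> small; apply: l2norm_small => e e0.
have c'0 : 0 < `|c| + 1 by rewrite ltr_wpDl.
apply: le_trans (small _ (divr_gt0 e0 c'0)) _.
rewrite mulrAC ler_pdivrMr// ler_wpM2l ?ltW//.
by apply: le_lt_trans (ler_norm c) _; rewrite ltrDl.
Qed.

Lemma commute_limit (P : set (V -> V)) T U : bounded_operator T ->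
  bounded_operator U ->
  (forall S, P S -> bounded_operator S /\ S \o T = T \o S) ->
  (forall e : R, 0 < e -> exists2 S, P S & opnorm (U - S) < e) ->
  U \o T = T \o U.
Proof.
move=> bT bU PP lim; apply/funext => x /=; apply/eqP; rewrite -subr_eq0.
have [M M0 MP] := bounded_operatorP bT; have [lT _] := bT.
apply/eqP/(@dist_le_small _ (l2norm (T x) + M * l2norm x)) => e e0.
have [S /PP[bS ST] lt] := lim e e0.
(* Since [S] commutes with [T], the commutator of [U] and [T] equals that of [U - S] and [T], which
   is small. *)
have -> : U (T x) - T (U x) = (U (T x) - S (T x)) - T (U x - S x).
  by rewrite linB// -[T (S x)](congr1 (@^~ x) ST) /= opprB addrA subrK.
apply: (le_trans (l2normB _ _)); rewrite mulrDr lerD//.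
  exact: opnorm_lt_dist.
apply: (le_trans (MP _)); rewrite mulrCA ler_wpM2l ?(ltW M0)//.
exact: opnorm_lt_dist.
Qed.

(** * Commutants, as C*-algebras that enclose generated ones *)

Definition commutant (P : set (V -> V)) : set (V -> V) :=
  [set T | bounded_operator T /\ forall S, P S -> T \o S = S \o T].

Lemma commutant_cstar (P : set (V -> V)) : P `<=` bounded_operator ->
  (forall S T T', P S -> is_adjoint T T' -> T \o S = S \o T ->
     T' \o S = S \o T') ->
  cstar_subalgebra (commutant P).
Proof.
move=> bP adjP; split.
- by move=> T [].
- split.
    split; first exact: bounded0.
    move=> S /bP[lS _]; apply/funext => x /=.
    by rewrite [(0 : V -> V) _](_ : _ = 0)// [RHS](lin0 lS).
  move=> a S T [bS PS] [bT PT]; split; first exact: bounded_lin.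
  move=> W PW; have [lW _] := bP _ PW; apply/funext => x /=.
  have := congr1 (@^~ x) (PS _ PW); have := congr1 (@^~ x) (PT _ PW).
  by rewrite /= !fun_linE lW => -> ->.
- move=> S T [bS PS] [bT PT]; split; first exact: bounded_comp.
  by move=> W PW; rewrite -compA (PT _ PW) compA (PS _ PW).
- move=> T [bT PT]; have [T' bT' TT'] := adjoint_exists bT.
  by exists T' => //; split=> // S PS; exact: adjP (PT _ PS).
- move=> U bU lim; split=> // T PT.
  apply: (@commute_limit (commutant P)) => //; first exact: bP.
  by move=> S [bS PS]; split=> //; exact: PS.
Qed.

Lemma cstar_adjoint (A : set (V -> V)) T S : cstar_subalgebra A -> A T ->
  is_adjoint T S -> A S.
Proof.
move=> [_ _ _ adj _] AT TS; have [S' AS' TS'] := adj T AT.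
by rewrite (is_adjoint_uniq TS TS').
Qed.

(** One enclosing [B] keeps the intersection from being over an empty family. It also supplies the
    adjoint, which by uniqueness is the same in every algebra of the family. *)
Lemma smallest_cstar (X B : set (V -> V)) : cstar_subalgebra B -> X `<=` B ->
  cstar_subalgebra (smallest cstar_subalgebra X).
Proof.
move=> cB XB; split.
- move=> T /(_ B (conj cB XB)); by have [bB _ _ _ _] := cB; exact: bB.
- split=> [A [[_ [A0 _] _ _ _] _]//|a S T AS AT A [cA XA]].
  by have [_ [_ Al] _ _ _] := cA; apply: Al; [apply: AS | apply: AT].
- move=> S T AS AT A [cA XA]; have [_ _ Ac _ _] := cA.
  by apply: Ac; [apply: AS | apply: AT].
- move=> T AT; have [_ _ _ adj _] := cB.
  have [S _ TS] := adj T (AT B (conj cB XB)); exists S => //.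
  by move=> A [cA XA]; apply: cstar_adjoint TS => //; exact: AT.
- move=> T bT lim A [cA XA]; have [_ _ _ _ cl] := cA; apply: cl => // e e0.
  by have [S AS lt] := lim e e0; exists S => //; apply: AS.
Qed.

Definition is_unitary W : Prop := linear W /\
  exists W', [/\ cancel W W', cancel W' W & forall x, nsq (W x) = nsq x].

Lemma unitary_bounded W : is_unitary W -> bounded_operator W.
Proof.
move=> [lW [W' [_ _ iW]]]; split=> //.
by exists 1 => x; rewrite mul1r !l2normE iW.
Qed.

Lemma unitary_inner W x y : is_unitary W -> inner (W x) (W y) = inner x y.
Proof.
move=> [lW [W' [_ _ iW]]].
have E u v : complex.Re (inner (W u) (W v)) = complex.Re (inner u v).
  by have := iW (u + v); rewrite linD// !nsqD !iW; lra.
apply/eqP; rewrite eq_complex E eqxx andTb; apply/eqP.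
have := E x ('i%C *: y); rewrite linZ// !innerZr.
by case: (inner _ _) (inner _ _) => [s t] [u v] /=; lra.
Qed.

(** The inverse [W'] is the adjoint of [W], and [T] commutes with [W'] as well; taking adjoints of
    that relation gives the claim. *)
Lemma unitary_commute_adjoint W T T' : is_unitary W -> is_adjoint T T' ->
  T \o W = W \o T -> T' \o W = W \o T'.
Proof.
move=> uW TT TW; have [lW [W' [W'W WW' iW]]] := uW.
have adj x y : inner (W x) y = inner x (W' y).
  by rewrite -{1}(WW' y) unitary_inner.
have TW' y : T (W' y) = W' (T y).
  by rewrite -[LHS]W'W -[W (T _)](congr1 (@^~ (W' y)) TW) /= WW'.
apply/funext => x /=; apply: inner_inj => y.
have TT' := is_adjoint_sym TT.
by rewrite TT' adj -TW' -TT' adj.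
Qed.

Lemma unitary_commutant_cstar (P : set (V -> V)) : P `<=` is_unitary ->
  cstar_subalgebra (commutant P).
Proof.
move=> uP; apply: commutant_cstar; first by move=> W /uP/unitary_bounded.
by move=> W T T' /uP; exact: unitary_commute_adjoint.
Qed.

(** If [U] commutes with [T] and has adjoint [U'], then [U' \o T] and [T \o U'] are both adjoints of
    [T \o U], hence equal. *)
Lemma self_adjoint_commutant_cstar T : bounded_operator T -> is_adjoint T T ->
  cstar_subalgebra (commutant [set T]).
Proof.
move=> bT TT; apply: commutant_cstar; first by move=> _ ->.
move=> _ U U' -> UU' UT; apply: (@is_adjoint_uniq _ _ (T \o U)).
  exact: is_adjoint_comp.
by rewrite -UT; exact: is_adjoint_comp.
Qed.

End bounded_operators.

(** * Nearest points of closed subspaces *)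

Section min_distance.
Local Open Scope ring_scope.
Context {R : realType} {G : choiceType}.
Local Notation V := (ell2 R G).
Implicit Types (x y z p q d : V).

Definition closed_subspace (E : set V) : Prop :=
  [/\ E 0, forall a x y, E x -> E y -> E (a *: x + y)
    & forall x, (forall e : R, 0 < e -> exists2 y, E y & l2norm (x - y) <= e) ->
        E x].

(** The midpoint of [p] and [q] is in [E], so its distance to [d] is at least [m]; the parallelogram
    law does the rest. Used twice: with [s] slightly above [m ^+ 2] minimizing sequences are Cauchy,
    and with [s = m ^+ 2] the nearest point is unique. *)
Lemma min_dist_parallelogram (E : set V) d (m s : R) p q : closed_subspace E ->
  0 <= m -> (forall z, E z -> m <= l2norm (d - z)) -> E p -> E q ->
  nsq (d - p) <= s -> nsq (d - q) <= s -> nsq (p - q) <= 4 * (s - m ^+ 2).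
Proof.
move=> [E0 El _] m0 mE Ep Eq ps qs.
have := parallelogram (d - q) (d - p).
have -> : d - q - (d - p) = p - q by rewrite opprB addrC addrA subrK addrC.
have Emid : E (2^-1 *: p + 2^-1 *: q).
  by apply: (El) => //; rewrite -[_ *: q]addr0; exact: El.
have -> : d - q + (d - p) = 2 *: (d - (2^-1 *: p + 2^-1 *: q)).
  rewrite scalerBr scalerDr !scalerA divff// !scale1r scalerDl !scale1r.
  by rewrite opprD addrACA [- q + _]addrC.
have sq2 : sqmod (2 : R[i]) = 4.
  by rewrite (_ : 2 = (2 : R)%:C)%C ?sqmod_real ?rmorph_nat//; ring.
rewrite nsqZ sq2.
have : m ^+ 2 <= nsq (d - (2^-1 *: p + 2^-1 *: q)).
  by rewrite -l2norm_sqr ler_pXn2r// ?nnegrE ?l2norm_ge0// mE.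
by lra.
Qed.

Lemma min_dist_exists (E : set V) d : closed_subspace E ->
  exists2 p, E p & forall q, E q -> l2norm (d - p) <= l2norm (d - q).
Proof.
move=> cE; have [E0 El Ec] := cE.
pose D := [set l2norm (d - q) | q in E].
have Dinf : has_inf D.
  split; first by exists (l2norm (d - 0)), 0.
  by exists 0 => _ [q _ <-]; exact: l2norm_ge0.
pose m := inf D.
have mE q : E q -> m <= l2norm (d - q) by move=> Eq; apply: ge_inf;
  [exact: (proj2 Dinf)|exists q].
have m0 : 0 <= m.
  by apply: lb_le_inf (proj1 Dinf) _ => _ [q _ <-]; exact: l2norm_ge0.
have /choice[u uP] : forall n : nat,
    exists q, E q /\ l2norm (d - q) < m + n.+1%:R^-1.
  move=> n; have n0 : 0 < n.+1%:R^-1 :> R by rewrite invr_gt0 ltr0Sn.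
  by have [_ [q Eq <-] lt] := inf_adherent n0 Dinf; exists q.
have inv_small (e : R) : 0 < e -> exists N : nat, forall n, (N <= n)%N ->
    n.+1%:R^-1 <= e.
  move=> e0; exists (Num.bound e^-1) => n Nn.
  have lt : e^-1 < n.+1%:R.
    apply: lt_le_trans (archi_boundP _) _; first by rewrite invr_ge0 ltW.
    by rewrite ler_nat ltnW.
  by rewrite -[e]invrK lef_pV2 ?posrE ?invr_gt0 ?ltr0Sn// ltW.
have inv_le1 n : n.+1%:R^-1 <= 1 :> R by rewrite invf_le1 ?ltr0Sn// ler1n.
have uC (e : R) : 0 < e -> exists N : nat, forall i j,
    (N <= i)%N -> (N <= j)%N -> l2norm (u i - u j) <= e.
  (* For [0 <= t <= 1], [(m + t) ^+ 2 <= m ^+ 2 + (2 * m + 1) * t]; the parallelogram bound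
     multiplies the excess by 4, so [t <= e ^+ 2 / c] leaves exactly [e ^+ 2]. *)
  move=> e0; pose c := 4 * (2 * m + 1); have c0 : 0 < c by rewrite /c; lra.
  have [N NP] := inv_small (e ^+ 2 / c) (divr_gt0 (exprn_gt0 2 e0) c0).
  exists N => i j Ni Nj.
  have bound k : (N <= k)%N -> nsq (d - u k) <= m ^+ 2 + (2 * m + 1) * (e ^+ 2 / c).
    move=> Nk; have [_ /ltW le] := uP k.
    apply: (@le_trans _ _ ((m + k.+1%:R^-1) ^+ 2)).
      rewrite -l2norm_sqr ler_pXn2r// nnegrE ?l2norm_ge0//.
      by rewrite addr_ge0// invr_ge0.
    have := NP k Nk; have := inv_le1 k.
    have : 0 <= k.+1%:R^-1 :> R by rewrite invr_ge0.
    move: (k.+1%:R^-1) (e ^+ 2 / c) => t s t0 t1 ts.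
    have : t ^+ 2 <= t by rewrite expr2 ler_piMl.
    have : (2 * m + 1) * t <= (2 * m + 1) * s by rewrite ler_wpM2l//; lra.
    by lra.
  have [[Ei _] [Ej _]] := (uP i, uP j).
  have := min_dist_parallelogram cE m0 mE Ei Ej (bound i Ni) (bound j Nj).
  have -> : 4 * (m ^+ 2 + (2 * m + 1) * (e ^+ 2 / c) - m ^+ 2) = e ^+ 2.
    rewrite /c; field; lra.
  by rewrite -l2norm_sqr ler_pXn2r// ?nnegrE ?l2norm_ge0 ?ltW.
have [l lP] := ell2_complete uC.
have ulim (e : R) : 0 < e -> exists N : nat,
    forall n, (N <= n)%N -> l2norm (u n - l) <= e.
  by move=> e0; have [N NP] := uC e e0; exists N; apply: lP => //; exact: ltW.
exists l.
  apply: Ec => e /ulim[N NP]; exists (u N); first exact: (proj1 (uP N)).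
  by rewrite -l2normN opprB NP.
move=> q Eq; apply: le_trans (mE q Eq).
apply/ler_addgt0Pr => e e0; have e2 : 0 < e / 2 by rewrite divr_gt0.
have [N NP] := ulim _ e2; have [N' NP'] := inv_small _ e2.
have {NP} := NP _ (leq_maxl N N'); have {NP'} := NP' _ (leq_maxr N N').
move: (maxn N N') => n le1 le2; have [_ /ltW le3] := uP n.
have := l2norm_dist d (u n) l; move: le1 le2 le3; clearbody m.
by move: (n.+1%:R^-1) (l2norm _) (l2norm _) (l2norm _) => *; lra.
Qed.

End min_distance.

(** * The left and right regular representations *)

Section monomial.
Local Open Scope ring_scope.
Context {R : realType} {G : choiceType}.
Local Notation V := (ell2 R G).

Lemma sqmod_unimodular (a : R[i]) : `|a| = 1 -> sqmod a = 1.
Proof. by move=> a1; apply: (@complexI R); rewrite sqmodE a1 expr1n. Qed.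

Lemma psum_reindex (p : G -> R) (f f' : G -> G) : cancel f f' -> cancel f' f ->
  psum (fun h => p (f h)) = psum p.
Proof.
move=> ff' f'f; congr fine; rewrite [RHS](reindex_esum setT setT f)//.
split=> // [h k _ _ /(can_inj ff')//|k _].
by exists (f' k).
Qed.

Lemma pos_summable_reindex (p : G -> R) (f f' : G -> G) :
  cancel f f' -> cancel f' f -> pos_summable p ->
  pos_summable (fun h => p (f h)).
Proof.
move=> ff' f'f [p0 pfin]; split=> [h|]; first exact: p0.
rewrite -(reindex_esum setT setT f (EFin \o p))//.
split=> // [h k _ _ /(can_inj ff')//|k _].
by exists (f' k).
Qed.

Lemma monomial_summable (u : G -> R[i]) (f f' : G -> G) (x : V) :
  cancel f f' -> cancel f' f -> (forall h, `|u h| = 1) ->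
  pos_summable (fun h => sqmod (u h * x (f h))).
Proof.
move=> ff' f'f u1.
have -> : (fun h => sqmod (u h * x (f h))) = (fun h => sqmod (x (f h))).
  by apply/funext => h; rewrite sqmodM sqmod_unimodular ?mul1r.
exact: pos_summable_reindex ff' f'f (ell2_pos_summable x).
Qed.

(** Common form of the left and right regular representations: a permutation of the coordinates with
    unimodular phases, inverted by the inverse permutation with conjugate phases. *)
Lemma monomial_unitary (W : V -> V) (u : G -> R[i]) (f f' : G -> G) :
  cancel f f' -> cancel f' f -> (forall h, `|u h| = 1) ->
  (forall x h, W x h = u h * x (f h)) -> is_unitary W.
Proof.
move=> ff' f'f u1 WE; split.
  by move=> a x y; apply: ell2_inj => h; rewrite !(ell2E, WE); ring.
have u1' h : `|(u (f' h))^*| = 1 by rewrite norm_conjC.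
pose W' (x : V) : V := Ell2 (pos_summable_ell2 (monomial_summable x f'f ff' u1')).
have W'E x h : W' x h = (u (f' h))^* * x (f' h) by [].
have uu h : u h * (u h)^* = 1 by rewrite mulr_conj sqmod_unimodular.
exists W'; split.
- move=> x; apply: ell2_inj => h.
  by rewrite W'E WE f'f mulrA [_^* * _]mulrC uu mul1r.
- by move=> x; apply: ell2_inj => h; rewrite WE W'E ff' mulrA uu mul1r.
- move=> x; rewrite /nsq -(psum_reindex (fun h => sqmod (x h)) ff' f'f).
  congr psum; apply/funext => h.
  by rewrite WE sqmodM sqmod_unimodular ?mul1r.
Qed.

End monomial.

Section regular_representations.
Local Open Scope ring_scope.
Context {R : realType} {G : groupType} (sigma : two_cocycle R G).
Local Notation V := (ell2 R G).
Local Notation e := (1%g : G).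
Implicit Types (x y : V) (g h k : G).

Lemma cocycle_sqmod g h : sqmod (sigma g h) = 1.
Proof. by rewrite sqmod_unimodular ?cocycle_norm. Qed.

Lemma cocycle_conj g h : sigma g h * (sigma g h)^* = 1.
Proof. by rewrite mulr_conj cocycle_sqmod. Qed.

Lemma cocycle_neq0 g h : sigma g h != 0.
Proof. by rewrite -normr_eq0 cocycle_norm oner_eq0. Qed.

Lemma cocycle_conjV g h : (sigma g h)^* = (sigma g h)^-1.
Proof.
by apply: (mulfI (cocycle_neq0 g h)); rewrite cocycle_conj mulfV ?cocycle_neq0.
Qed.

Lemma cocycleV g : sigma g g^-1%g = sigma g^-1%g g.
Proof.
have := cocycleM sigma g g^-1%g g.
by rewrite mulgV mulVg cocycle1g cocycleg1 mulr1 mul1r.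
Qed.

Lemma lambdaE g x h :
  lambda sigma g x h = sigma g (g^-1 * h)%g * x (g^-1 * h)%g.
Proof. by []. Qed.

Lemma lambda_unitary g : is_unitary (lambda sigma g).
Proof.
apply: (@monomial_unitary _ _ _ (fun h => sigma g (g^-1 * h)%g)
  (fun h => (g^-1 * h)%g) (fun h => (g * h)%g)) => //.
- exact: mulVKg.
- exact: mulKg.
- by move=> h; rewrite cocycle_norm.
Qed.

(** Right translation carries the conjugate cocycle; with this phase the cocycle identity for [k],
    [k^-1 * h], [g] makes it commute with [lambda sigma k]. *)
Definition rho g x : V :=
  Ell2 (pos_summable_ell2 (monomial_summable x (mulgK g) (mulgVK g)
    (fun h => etrans (norm_conjC (sigma h g)) (cocycle_norm sigma h g)))).

Lemma rhoE g x h : rho g x h = (sigma h g)^* * x (h * g)%g.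
Proof. by []. Qed.

Lemma rho_unitary g : is_unitary (rho g).
Proof.
apply: (@monomial_unitary _ _ _ (fun h => (sigma h g)^*)
  (fun h => (h * g)%g) (fun h => (h * g^-1)%g)) => //.
- exact: mulgK.
- exact: mulgVK.
- by move=> h; rewrite norm_conjC cocycle_norm.
Qed.

Lemma lambda_rho_comm g k x :
  lambda sigma k (rho g x) = rho g (lambda sigma k x).
Proof.
apply: ell2_inj => h; rewrite lambdaE rhoE rhoE lambdaE !mulrA mulgA.
congr (_ * _); rewrite !cocycle_conjV.
have := cocycleM sigma k (k^-1 * h)%g g; rewrite mulVKg => cM.
apply: (mulIf (cocycle_neq0 h g)); apply: (mulIf (cocycle_neq0 (k^-1 * h)%g g)).
rewrite [LHS]mulrAC divfK ?cocycle_neq0// cM.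
by rewrite [_^-1 * _]mulrC divfK ?cocycle_neq0.
Qed.

Lemma lambda1 : lambda sigma e = idfun.
Proof.
by apply/funext => x; apply: ell2_inj => h; rewrite lambdaE invg1 mul1g cocycle1g mul1r.
Qed.

Lemma lambda_delta g k :
  lambda sigma g (delta k) = sigma g k *: delta (g * k)%g.
Proof.
apply: ell2_inj => h; rewrite lambdaE ell2Z !deltaE.
rewrite -(inj_eq (mulgI g)) mulVKg; case: eqP => [->|_]; last by rewrite !mulr0.
by rewrite mulKg.
Qed.

Lemma rho_delta g : rho g^-1%g (delta e) = (sigma g g^-1%g)^* *: delta g.
Proof.
apply: ell2_inj => h; rewrite rhoE ell2Z !deltaE.
rewrite -(inj_eq (mulIg g)) mulgVK mul1g.
by case: eqP => [->//|_]; rewrite !mulr0.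
Qed.

(** [delta e] is cyclic for [rho], so an operator commuting with [rho] is determined by its value
    there. *)
Lemma delta_rho g : delta g = sigma g g^-1%g *: rho g^-1%g (delta e).
Proof. by rewrite rho_delta scalerA cocycle_conj scale1r. Qed.

Definition conj_shift h x : V := lambda sigma h (rho h x).

Lemma conj_shiftE h x k : conj_shift h x k =
  sigma h (h^-1 * k)%g * (sigma (h^-1 * k)%g h)^* * x (h^-1 * k * h)%g.
Proof. by rewrite /conj_shift lambdaE rhoE mulrA. Qed.

Lemma conj_shift_delta h : conj_shift h (delta e) = delta e.
Proof.
apply: ell2_inj => k; rewrite conj_shiftE !deltaE.
rewrite -(inj_eq (mulIg h^-1%g)) mulgK mul1g -(inj_eq (mulgI h)) mulVKg mulgV.
case: eqP => [->|_]; last by rewrite mulr0.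
by rewrite mulg1 mulr1 -cocycleV cocycle_conj.
Qed.

Lemma conj_shift_nsq h x y : nsq (conj_shift h x - conj_shift h y) = nsq (x - y).
Proof.
have [lW [_ [_ _ iW]]] := lambda_unitary h.
have [lW' [_ [_ _ iW']]] := rho_unitary h.
by rewrite /conj_shift -(linB _ _ lW) iW -(linB _ _ lW') iW'.
Qed.

(* The von Neumann algebra generated by [rho], presented by its unitaries:
   every operator of C*_r(G, sigma) commutes with it. *)
Definition right_unitaries : set (V -> V) :=
  [set W | is_unitary W /\ forall g, lambda sigma g \o W = W \o lambda sigma g].

Lemma cstar_r_commutant : cstar_r sigma setT `<=` commutant right_unitaries.
Proof.
apply: smallest_sub; first by apply: unitary_commutant_cstar => W [].
move=> _ [g _ <-]; split; first exact: unitary_bounded (lambda_unitary g).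
by move=> W [_ ->].
Qed.

Lemma cstar_r_rho T g x : cstar_r sigma setT T -> T (rho g x) = rho g (T x).
Proof.
move=> /cstar_r_commutant[_ /(_ (rho g)) TP].
apply: (congr1 (@^~ x) (TP _)); split; first exact: rho_unitary.
by move=> k; apply/funext => y /=; exact: lambda_rho_comm.
Qed.

Lemma cstar_r_bounded T : cstar_r sigma setT T -> bounded_operator T.
Proof. by move=> /cstar_r_commutant[]. Qed.

Lemma scalar_of_vector T (c : R[i]) : cstar_r sigma setT T ->
  T (delta e) = c *: delta e -> T = c *: idfun.
Proof.
move=> rT Te; apply: bounded_eq_on_delta; first exact: cstar_r_bounded.
  exact: bounded_scale bounded_id.
have [lT _] := cstar_r_bounded rT.
move=> g; rewrite [RHS](_ : _ = c *: delta g)// delta_rho linZ// cstar_r_rho// Te.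
have [lr _] := rho_unitary g^-1%g.
by rewrite linZ// !scalerA mulrC.
Qed.

(** * Consequences of the relative Kleppner condition *)

Section kleppner.
Context (H : set G) (subgroup_H : group_closed [in H]).

Lemma subgroup1 : H e.
Proof. by have [H1 _] := subgroup_H; exact: set_mem H1. Qed.

Lemma subgroupV h : H h -> H h^-1%g.
Proof.
by move=> Hh; exact: set_mem (group_closedV subgroup_H (mem_set Hh)).
Qed.

Lemma subgroupM h k : H h -> H k -> H (h * k)%g.
Proof.
move=> Hh Hk.
exact: set_mem (group_closedM subgroup_H (mem_set Hh) (mem_set Hk)).
Qed.

Lemma fixed_vector_regular x g : x g != 0 ->
  (forall h, H h -> conj_shift h x = x) -> regular_wrt sigma H g.
Proof.
move=> xg fx h Hh gh.
(* Since [h] commutes with [g], the coordinate at [g] is only multiplied by a phase, which must be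
   1. The cocycle identity for [h], [h^-1 * g], [h] turns this into [sigma g h = sigma h g]. *)
have := congr1 (fun y : V => y g) (fx h Hh).
have hgh : (h^-1 * g * h = g)%g by rewrite -mulgA gh mulKg.
rewrite conj_shiftE hgh -[RHS]mul1r => /(mulIf xg) E.
rewrite cocycle_conjV in E.
have {}E : sigma h (h^-1 * g)%g = sigma (h^-1 * g)%g h.
  by rewrite -[RHS]mul1r -E divfK ?cocycle_neq0.
have := cocycleM sigma h (h^-1 * g)%g h.
rewrite mulVKg hgh E mulrC => /(mulIf (cocycle_neq0 _ _)).
by [].
Qed.

Lemma fixed_vector_sqmod x g h : conj_shift h x = x ->
  sqmod (x (h * g * h^-1)%g) = sqmod (x g).
Proof.
move=> /(congr1 (fun y : V => y (h * g * h^-1)%g)) <-.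
rewrite conj_shiftE !sqmodM sqmodC !cocycle_sqmod !mul1r.
by rewrite !mulgA mulVg mul1g mulgVK.
Qed.

(** The modulus of [x] is constant on [H]-conjugacy classes, and a class meeting the support of [x]
    is regular. Off the identity such a class would be infinite, against square summability. *)
Lemma fixed_vector_scalar x : relative_Kleppner sigma H ->
  (forall h, H h -> conj_shift h x = x) -> x = x e *: delta e.
Proof.
move=> kH fx.
suff x0 g : g <> e -> x g = 0.
  apply: ell2_inj => g; rewrite ell2Z deltaE.
  by case: eqP => [->|/x0 ->]; rewrite ?mulr1 ?mulr0.
move=> gn1; apply/eqP; apply: contrapT => /negP xg.
have inf := kH g gn1 (fixed_vector_regular xg fx).
have sp : 0 < sqmod (x g).
  rewrite lt_def sqmod_ge0 andbT; apply/eqP => /sqmod_eq0 x0.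
  by rewrite x0 eqxx in xg.
(* So many points of the class that their equal contributions exceed [nsq x]. *)
have [B Bsub Bn] := infinite_set_fset (Num.bound (nsq x / sqmod (x g))) inf.
have := sum_le_nsq x B; apply/negP; rewrite -ltNge.
rewrite big_seq (eq_bigr (fun=> sqmod (x g))); last first.
  by move=> k /Bsub[h Hh <-]; rewrite fixed_vector_sqmod// fx.
rewrite -big_seq big_const_seq count_predT iter_addr_0 -mulr_natl -ltr_pdivrMr//.
apply: lt_le_trans (archi_boundP _) _; first by rewrite divr_ge0 ?nsq_ge0 ?sqmod_ge0.
by rewrite ler_nat.
Qed.

Lemma invariant_subspace (E : set V) : relative_Kleppner sigma H ->
  closed_subspace E -> (forall h x, H h -> E x -> E (lambda sigma h x)) ->
  (forall g x, E x -> E (rho g x)) ->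
  (forall g, E (delta g)) \/ (forall x, E x -> x = 0).
Proof.
move=> kH cE Elam Erho; have [E0 El Ec] := cE.
have [p Ep pmin] := min_dist_exists (delta e) cE.
have EZ a x : E x -> E (a *: x) by move=> Ex; rewrite -[_ *: x]addr0; exact: El.
have fp h : H h -> conj_shift h p = p.
  move=> Hh; have Eq : E (conj_shift h p) by apply: Elam => //; exact: Erho.
  (* [conj_shift] is isometric and fixes [delta e], so [p] and its image are equally near to
     [delta e]; the bound with [s] the squared minimum is 0. *)
  have := min_dist_parallelogram (s := nsq (delta e - p)) cE (l2norm_ge0 _) pmin Eq Ep.
  rewrite -{1}(conj_shift_delta h) conj_shift_nsq l2norm_sqr subrr mulr0.
  move=> /(_ (lexx _) (lexx _)) le0; apply/eqP; rewrite -subr_eq0; apply/eqP.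
  by apply: nsq_eq0; apply/eqP; rewrite eq_le le0 nsq_ge0.
have pE := fixed_vector_scalar kH fp.
have [pe|pe] := eqVneq (p e) 0; last first.
  left=> g; rewrite delta_rho; apply/EZ/Erho.
  by rewrite -[delta e]scale1r -(mulVf pe) -scalerA -pE; exact: EZ.
right=> x Ex.
have p0 : p = 0 by rewrite pE pe scale0r.
have orth y : E y -> y e = 0.
  move=> Ey; have [y0|y0] := eqVneq (nsq y) 0; first by rewrite (nsq_eq0 y0).
  have yp : 0 < nsq y by rewrite lt_def y0 nsq_ge0.
  (* [t *: y] is the projection of [delta e] onto the line of [y]. As 0 is already a nearest point,
     this projection must vanish. *)
  pose t : R[i] := (y e)^* * ((nsq y)^-1)%:C%C.
  have := pmin _ (EZ t y Ey); rewrite p0 subr0.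
  rewrite -(@ler_pXn2r _ 2)// ?nnegrE ?l2norm_ge0// !l2norm_sqr.
  rewrite nsqB nsqZ nsq_delta innerZr [inner (delta e) _]inner_conj inner_delta.
  rewrite /t sqmodM sqmodC sqmod_real.
  have -> : complex.Re (((y e)^* * ((nsq y)^-1)%:C%C)^* * (y e)^*) =
      sqmod (y e) / nsq y.
    by case: (y e) => a b; rewrite /sqmod /=; ring.
  have -> : sqmod (y e) * (nsq y)^-1 ^+ 2 * nsq y = sqmod (y e) / nsq y by field.
  move=> le; apply: sqmod_eq0; apply/eqP; rewrite eq_le sqmod_ge0 andbT.
  have : sqmod (y e) / nsq y <= 0 by lra.
  by rewrite ler_pdivrMr// mul0r.
(* Up to a phase, [x g] is the coordinate at [e] of [rho g x], which is again in [E]. *)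
apply: ell2_inj => g; rewrite ell20; have := orth _ (Erho g x Ex).
rewrite rhoE mul1g => /eqP; rewrite mulf_eq0 conjC_eq0.
by rewrite (negPf (cocycle_neq0 _ _)) => /eqP.
Qed.

Lemma Kleppner_trivial_center (A : set (V -> V)) : relative_Kleppner sigma H ->
  cstar_subalgebra A -> cstar_r sigma H `<=` A -> A `<=` cstar_r sigma setT ->
  trivial_center A.
Proof.
move=> kH cA HA AG; have [bA [A0 Al] _ _ _] := cA.
have lamA h : H h -> A (lambda sigma h).
  by move=> Hh; apply: HA => B [_]; apply; exists h.
apply/seteqP; split=> [T [AT cT]|_ [a _ <-]].
  have rT := AG _ AT; exists ((T (delta e)) e) => //; apply/esym.
  apply: scalar_of_vector => //; apply: fixed_vector_scalar => // h Hh.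
  rewrite /conj_shift -cstar_r_rho//.
  rewrite -[LHS](congr1 (@^~ (rho h (delta e))) (cT _ (lamA h Hh))) /=.
  by rewrite -/(conj_shift h (delta e)) conj_shift_delta.
split.
  rewrite -[_ *: _]addr0; apply: Al A0; rewrite -lambda1; exact/lamA/subgroup1.
by move=> S /bA[lS _]; apply/funext => x /=; rewrite [RHS]linZ.
Qed.

Lemma Kleppner_prime (A : set (V -> V)) : relative_Kleppner sigma H ->
  cstar_subalgebra A -> cstar_r sigma H `<=` A -> A `<=` cstar_r sigma setT ->
  prime_algebra A.
Proof.
move=> kH cA HA AG J K [JA [J0 Jl] JM Jc] [KA [K0 Kl] KM Kc] Jn0 Kn0 JK0.
have [bA _ _ _ _] := cA.
have lamA h : H h -> A (lambda sigma h).
  by move=> Hh; apply: HA => B [_]; apply; exists h.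
have JK S T : J S -> K T -> S \o T = 0.
  move=> JS KT; have : (J `&` K) (S \o T).
    split; first exact: proj2 (JM _ _ (KA _ KT) JS).
    exact: proj1 (KM _ _ (JA _ JS) KT).
  by rewrite JK0.
pose E := [set x : V | forall T, J T -> T x = 0].
have bJ T : J T -> bounded_operator T by move=> /JA/bA.
have [|||EJ|EK] := @invariant_subspace E kH.
- split.
  + by move=> T /bJ[lT _]; rewrite lin0.
  + move=> a x y Ex Ey T JT; have [lT _] := bJ _ JT.
    by rewrite lT Ex// Ey// scaler0 addr0.
  + move=> x lim T JT; have [lT _] := bJ _ JT.
    have [M M0 MP] := bounded_operatorP (bJ _ JT).
    apply: (@dist_le_small _ _ _ M) => d d0; have [y Ey le] := lim d d0.
    rewrite -[T x]subr0 -(Ey T JT) -linB// mulrC.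
    by apply: (le_trans (MP _)); rewrite ler_wpM2l// ltW.
(* [T \o lambda sigma h] is again in [J], so it kills [x]; invariance under [rho] holds because [T]
   commutes with it. *)
- move=> h x Hh Ex T JT.
  exact: (Ex _ (proj2 (JM _ _ (lamA h Hh) JT))).
- move=> g x Ex T JT; rewrite (cstar_r_rho g x (AG _ (JA _ JT))) Ex//.
  by have [lr _] := rho_unitary g; exact: lin0 lr.
- apply: Jn0; apply/seteqP; split=> [T JT|_ ->//].
  apply: bounded_eq_on_delta; [exact: bJ|exact: bounded0|].
  by move=> g; rewrite EJ.
- apply: Kn0; apply/seteqP; split=> [T KT|_ ->//].
  apply/funext => x; apply: EK => S JS.
  exact: (congr1 (@^~ x) (JK _ _ JS KT)).
Qed.

End kleppner.
End regular_representations.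

(** * Absolute value of a self-adjoint contraction *)

Section square_root.
Local Open Scope complex_scope.
Local Open Scope ring_scope.
Context {R : realType} {G : choiceType}.
Local Notation V := (ell2 R G).
Local Notation center := Defs.center.
Implicit Types (x y v : V) (S T : V -> V).

(* Scalar majorant of the operator iteration [sqrt_iter] below. *)
Fixpoint sqrt_bound (n : nat) : R :=
  if n is m.+1 then 2^-1 * (1 + sqrt_bound m ^+ 2) else 0.

Lemma sqrt_bound_ge0 n : 0 <= sqrt_bound n.
Proof.
by elim: n => //= n IH; rewrite mulr_ge0 ?invr_ge0// addr_ge0// sqr_ge0.
Qed.

Lemma sqrt_bound_le1 n : sqrt_bound n <= 1.
Proof.
elim: n => [|n IH] /=; first exact: ler01.
by have := sqrt_bound_ge0 n; move: (sqrt_bound n) IH => t; nra.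
Qed.

Lemma sqrt_bound_cauchy (e : R) : 0 < e -> exists N : nat, forall m n,
  (N <= m)%N -> (N <= n)%N -> sqrt_bound m - sqrt_bound n <= e.
Proof.
move=> e0; have incr n : sqrt_bound n <= sqrt_bound n.+1.
  (* With [t] the current bound, the increment is [(1 - t) ^+ 2 / 2]. *)
  by rewrite /=; have := sqr_ge0 (1 - sqrt_bound n); move: (sqrt_bound n) => t; nra.
have mono : {homo sqrt_bound : m n / (m <= n)%N >-> m <= n}.
  by apply: homo_leq => // y x z; exact: le_trans.
have sp : has_sup (range sqrt_bound).
  by split; [exists 0, 0%N | exists 1 => _ [n _ <-]; exact: sqrt_bound_le1].
have [_ [N _ <-] lt] := sup_adherent e0 sp.
exists N => m n Nm Nn; have := mono _ _ Nn.
have : sqrt_bound m <= sup (range sqrt_bound).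
  by apply: sup_upper_bound => //; exists m.
by move: lt; lra.
Qed.

Lemma le_add_small (a b c : R) : (forall e : R, 0 < e -> a <= b + e * c) -> a <= b.
Proof.
move=> small; apply/ler_addgt0Pr => /= e e0.
have c'0 : 0 < `|c| + 1 by rewrite ltr_wpDl.
apply: le_trans (small _ (divr_gt0 e0 c'0)) _.
rewrite lerD2l mulrAC ler_pdivrMr// ler_wpM2l// ?(ltW e0)//.
by apply: le_trans (ler_norm c) _; rewrite lerDl.
Qed.

(** * The square root of [Y^2] as a norm limit in the center of [A] *)

Section iteration.
Context (A : set (V -> V)) (cA : cstar_subalgebra A) (A1 : A idfun).
Context (Y : V -> V) (centerY : center A Y) (YY : is_adjoint Y Y).
Context (Y1 : forall x, l2norm (Y x) <= l2norm x).

Let bA T : A T -> bounded_operator T.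
Proof. by have [bA _ _ _ _] := cA; exact: bA. Qed.

Let lA T : A T -> linear T. Proof. by move=> /bA[]. Qed.

Lemma center_lin (a : R[i]) S T : center A S -> center A T ->
  center A (a *: S + T).
Proof.
have [_ [_ Al] _ _ _] := cA; move=> [AS cS] [AT cT]; split; first exact: Al.
move=> W AW; apply/funext => x; rewrite /= !fun_linE lA//.
by rewrite [S (W x)](congr1 (@^~ x) (cS W AW)) [T (W x)](congr1 (@^~ x) (cT W AW)).
Qed.

Lemma center_comp S T : center A S -> center A T -> center A (S \o T).
Proof.
have [_ _ Ac _ _] := cA; move=> [AS cS] [AT cT]; split; first exact: Ac.
by move=> W AW; rewrite -compA cT// compA cS.
Qed.

Lemma center_id : center A idfun. Proof. by split. Qed.

Lemma center_scale (a : R[i]) S : center A S -> center A (a *: S).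
Proof.
have [_ [A0 _] _ _ _] := cA => cS; rewrite -[_ *: _]addr0; apply: center_lin => //.
split=> // W AW; apply/funext => x /=.
by rewrite [(0 : V -> V) _](_ : _ = 0)// [RHS](lin0 (lA AW)).
Qed.

(** Each iterate is a polynomial in [Y^2], so all of them are central and self-adjoint; the limit
    plays the part of [idfun - |Y|]. *)
Fixpoint sqrt_iter (n : nat) : V -> V :=
  if n is m.+1
  then 2^-1 *: (idfun - (Y \o Y) + (sqrt_iter m \o sqrt_iter m)) else 0.

Lemma sqrt_iterS n x :
  sqrt_iter n.+1 x = 2^-1 *: (x - Y (Y x) + sqrt_iter n (sqrt_iter n x)).
Proof. by []. Qed.

Lemma sqrt_iter_center n : center A (sqrt_iter n).
Proof.
elim: n => [|n IH].
  by have := center_scale 0 center_id; rewrite scale0r.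
apply: center_scale; rewrite -[X in X + _]scale1r.
apply: center_lin; last exact: center_comp.
rewrite addrC -scaleN1r; apply: center_lin; last exact: center_id.
exact: center_comp.
Qed.

Lemma sqrt_iter_self_adjoint n : is_adjoint (sqrt_iter n) (sqrt_iter n).
Proof.
elim: n => [|n IH] x y.
  by rewrite /= [(0 : V -> V) x](_ : _ = 0)// [(0 : V -> V) y](_ : _ = 0)//
    inner0l inner0r.
have c2 : (2^-1 : R[i])^* = 2^-1 by rewrite fmorphV rmorph_nat.
rewrite !sqrt_iterS innerZl innerZr c2; congr (_ * _).
by rewrite !(innerDl, innerDr, innerNl, innerNr) !YY !IH.
Qed.

(** Self-adjointness makes the cross term [- 2 * nsq (Y x)], which outweighs [nsq (Y (Y x))] because
    [Y] is a contraction. *)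
Lemma Y2_contraction x : l2norm (x - Y (Y x)) <= l2norm x.
Proof.
rewrite !l2normE ler_wsqrtr// nsqB -YY inner_xx /=.
have := nsq_ge0 (Y x); have : nsq (Y (Y x)) <= nsq (Y x).
  by rewrite -!l2norm_sqr ler_pXn2r// ?nnegrE ?l2norm_ge0.
by lra.
Qed.

Lemma cabs_half : cabs (2^-1 : R[i]) = 2^-1.
Proof.
have -> : (2^-1 : R[i]) = (2^-1 : R)%:C by rewrite fmorphV rmorph_nat.
by rewrite cabs_real// invr_ge0.
Qed.

Lemma sqrt_iter_le n x : l2norm (sqrt_iter n x) <= sqrt_bound n * l2norm x.
Proof.
elim: n x => [|n IH] x; first by rewrite mul0r [sqrt_iter 0 x](_ : _ = 0)// l2norm0.
rewrite sqrt_iterS l2normZ cabs_half.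
have -> : sqrt_bound n.+1 * l2norm x =
    2^-1 * (l2norm x + sqrt_bound n * (sqrt_bound n * l2norm x)).
  by rewrite [sqrt_bound n.+1]/=; ring.
apply: ler_wpM2l; first by rewrite invr_ge0.
apply: le_trans (l2normD _ _) _; apply: lerD; first exact: Y2_contraction.
apply: le_trans (IH _) _; apply: ler_wpM2l; first exact: sqrt_bound_ge0.
exact: IH.
Qed.

(** With [D] the difference of consecutive iterates [B] and [C], [B^2 - C^2 = B D + D C]. The scalar
    bounds factor in the same way, so induction carries the estimate over. *)
Lemma sqrt_iter_step n x : l2norm (sqrt_iter n.+1 x - sqrt_iter n x) <=
  (sqrt_bound n.+1 - sqrt_bound n) * l2norm x.
Proof.
elim: n x => [|n IH] x.
  rewrite [sqrt_iter 0 x](_ : _ = 0)// [sqrt_bound 0](_ : _ = 0)// !subr0.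
  exact: sqrt_iter_le.
pose B := sqrt_iter n.+1; pose D x := B x - sqrt_iter n x.
have lB : linear B by have [/lA] := sqrt_iter_center n.+1.
have -> : sqrt_iter n.+2 x - sqrt_iter n.+1 x =
    2^-1 *: (B (D x) + D (sqrt_iter n x)).
  rewrite sqrt_iterS (sqrt_iterS n x) -scalerBr opprD addrACA subrr add0r.
  by rewrite /D (linB _ _ lB) addrA subrK.
rewrite l2normZ cabs_half.
have -> : sqrt_bound n.+2 - sqrt_bound n.+1 =
    2^-1 * (sqrt_bound n.+1 * (sqrt_bound n.+1 - sqrt_bound n) +
            (sqrt_bound n.+1 - sqrt_bound n) * sqrt_bound n).
  by rewrite [sqrt_bound n.+2]/= -/(sqrt_bound n.+1) [in X in _ - X]/=;
    move: (sqrt_bound n) => t /=; field.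
rewrite -mulrA ler_wpM2l ?invr_ge0//; apply: (le_trans (l2normD _ _)).
have d0 : 0 <= sqrt_bound n.+1 - sqrt_bound n.
  by rewrite /=; have := sqr_ge0 (1 - sqrt_bound n); move: (sqrt_bound n) => t; nra.
rewrite mulrDl; apply: lerD.
  apply: (le_trans (sqrt_iter_le _ _)); rewrite -mulrA.
  by apply: ler_wpM2l; [exact: sqrt_bound_ge0 | exact: IH].
apply: (le_trans (IH _)); rewrite -mulrA ler_wpM2l//.
exact: sqrt_iter_le.
Qed.

Lemma sqrt_iter_dist m n x : (n <= m)%N ->
  l2norm (sqrt_iter m x - sqrt_iter n x) <=
  (sqrt_bound m - sqrt_bound n) * l2norm x.
Proof.
move=> /subnK <-; elim: (m - n)%N => [|k IH].
  by rewrite !subrr l2norm0 mul0r.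
rewrite addSn; apply: (le_trans (l2norm_dist _ (sqrt_iter (k + n) x) _)).
apply: (le_trans (lerD (sqrt_iter_step _ _) IH)).
by rewrite -mulrDl addrA subrK.
Qed.

(** The limit is built vector by vector, but the Cauchy estimates are proportional to [l2norm x], so
    the convergence is in operator norm. *)
Lemma sqrt_iter_limit : exists B : V -> V, forall e : R, 0 < e ->
  exists N : nat, forall n x, (N <= n)%N ->
    l2norm (B x - sqrt_iter n x) <= e * l2norm x.
Proof.
have cau (e : R) : 0 < e -> exists N : nat, forall x m n,
    (N <= m)%N -> (N <= n)%N ->
    l2norm (sqrt_iter m x - sqrt_iter n x) <= e * l2norm x.
  move=> e0; have [N NP] := sqrt_bound_cauchy e0; exists N => x m n Nm Nn.
  wlog le : m n Nm Nn / (n <= m)%N => [hw|].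
    have [|/ltnW] := leqP n m; first exact: hw.
    by move=> mn; rewrite -l2normN opprB; exact: hw.
  apply: (le_trans (sqrt_iter_dist x le)).
  by rewrite ler_wpM2r ?l2norm_ge0// NP.
have /choice[B BP] : forall x, exists l : V, forall (e : R) N, 0 <= e ->
    (forall m n, (N <= m)%N -> (N <= n)%N ->
       l2norm (sqrt_iter m x - sqrt_iter n x) <= e) ->
    forall n, (N <= n)%N -> l2norm (sqrt_iter n x - l) <= e.
  move=> x; apply: ell2_complete => e e0.
  have c'0 : 0 < l2norm x + 1 by rewrite ltr_wpDl ?l2norm_ge0.
  have [N NP] := cau _ (divr_gt0 e0 c'0); exists N => m n Nm Nn.
  apply: (le_trans (NP x m n Nm Nn)).
  by rewrite mulrAC ler_pdivrMr// ler_wpM2l ?(ltW e0)// lerDl.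
exists B => e e0; have [N NP] := cau e e0; exists N => n x Nn.
rewrite -l2normN opprB; apply: (BP x (e * l2norm x) N) => //.
  by rewrite mulr_ge0 ?l2norm_ge0 ?(ltW e0).
by move=> m k; exact: NP.
Qed.

(* [idfun - B] is the square root of [Y^2]: the iteration
   [B := (1 - Y^2 + B^2) / 2] has a fixed point with [(1 - B)^2 = Y^2]. *)
Lemma contraction_sqrt : exists B : V -> V,
  [/\ center A B, is_adjoint B B, forall x, l2norm (B x) <= l2norm x
    & forall x, x - B x - B (x - B x) = Y (Y x)].
Proof.
have [B Blim] := sqrt_iter_limit.
have lI n : linear (sqrt_iter n) by have [/lA] := sqrt_iter_center n.
have Bn1 n x : l2norm (sqrt_iter n x) <= l2norm x.
  apply: (le_trans (sqrt_iter_le _ _)).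
  by rewrite -[leRHS]mul1r ler_wpM2r ?l2norm_ge0// sqrt_bound_le1.
have lB : linear B.
  move=> a x y; apply/eqP; rewrite -subr_eq0; apply/eqP.
  apply: (@dist_le_small _ _ _
    (l2norm (a *: x + y) + (cabs a * l2norm x + l2norm y))) => e e0.
  have [N NP] := Blim e e0.
  have -> : B (a *: x + y) - (a *: B x + B y) =
      (B (a *: x + y) - sqrt_iter N (a *: x + y)) -
      (a *: (B x - sqrt_iter N x) + (B y - sqrt_iter N y)).
    rewrite lI scalerBr; move: (B _) (B x) (B y) => u v w.
    apply: ell2_inj => h; rewrite !ell2E; ring.
  apply: (le_trans (l2normB _ _)); rewrite mulrDr; apply: lerD; first exact: NP.
  apply: (le_trans (l2normD _ _)); rewrite mulrDr; apply: lerD; last exact: NP.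
  rewrite l2normZ mulrCA; apply: ler_wpM2l; first exact: cabs_ge0.
  exact: NP.
have B1 x : l2norm (B x) <= l2norm x.
  apply: (@le_add_small _ _ (l2norm x)) => e /Blim[N NP].
  rewrite -[B x](subrK (sqrt_iter N x)) addrC.
  apply: (le_trans (l2normD _ _)); apply: lerD; last exact: NP.
  exact: Bn1.
have bB : bounded_operator B.
  by split=> //; exists 1 => x; rewrite mul1r.
have Bop (e : R) : 0 < e ->
    exists2 S, center A S & opnorm (B - S) < e.
  move=> e0; have e2 : 0 < e / 2 by rewrite divr_gt0.
  have [N NP] := Blim _ e2; exists (sqrt_iter N); first exact: sqrt_iter_center.
  apply: (@le_lt_trans _ _ (e / 2)); last by rewrite ltr_pdivrMr// ltr_pMr// ltr1n.
  have bI := bA (proj1 (sqrt_iter_center N)).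
  apply: opnorm_le; [by have [] := bounded_sub bB bI|exact: ltW|].
  by move=> x; exact: NP.
exists B; split=> //.
- split.
    have [_ _ _ _ cl] := cA; apply: cl => // e /Bop[S [AS _] lt].
    by exists S.
  move=> S AS; apply: (@commute_limit _ _ (center A)) => //; first exact: bA.
  by move=> T [AT cT]; split; [exact: bA|exact: cT].
- move=> x y; apply/eqP; rewrite -subr_eq0; apply/eqP/cabs_small => d d0.
  apply: le_trans (ltW d0).
  apply: (@le_add_small _ _ (2 * (l2norm x * l2norm y))) => e /Blim[N NP].
  have -> : inner (B x) y - inner x (B y) =
      inner (B x - sqrt_iter N x) y - inner x (B y - sqrt_iter N y).
    rewrite innerBl innerBr sqrt_iter_self_adjoint; ring.
  rewrite add0r; apply: (le_trans (cabsB _ _)).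
  have h1 : cabs (inner (B x - sqrt_iter N x) y) <= e * (l2norm x * l2norm y).
    apply: (le_trans (cauchy_schwarz _ _)).
    by rewrite mulrA; apply: ler_wpM2r; [exact: l2norm_ge0 | exact: NP].
  have h2 : cabs (inner x (B y - sqrt_iter N y)) <= e * (l2norm x * l2norm y).
    apply: (le_trans (cauchy_schwarz _ _)).
    by rewrite mulrCA; apply: ler_wpM2l; [exact: l2norm_ge0 | exact: NP].
  by move: h1 h2; move: (cabs _) (cabs _) (l2norm x * l2norm y) => *; lra.
- move=> x.
  have fix_ : B x = 2^-1 *: (x - Y (Y x) + B (B x)).
    apply/eqP; rewrite -subr_eq0; apply/eqP.
    apply: (@dist_le_small _ _ _ (2 * l2norm x)) => e e0.
    (* Iterate [N.+1] approximates the left side and the recursion from iterate [N] the right side;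
       the errors add up to at most [e + (e + e) / 2] times [l2norm x]. *)
    have [N NP] := Blim e e0; have NS := leqnSn N.
    have -> : B x - 2^-1 *: (x - Y (Y x) + B (B x)) =
        (B x - sqrt_iter N.+1 x) - 2^-1 *: ((B (B x) - sqrt_iter N (B x)) +
          sqrt_iter N (B x - sqrt_iter N x)).
      rewrite sqrt_iterS (linB _ _ (lI N)).
      move: (B x) (B _) (Y _) (sqrt_iter N (B x)) => b bb yy ib.
      by apply: ell2_inj => h; rewrite !ell2E; field.
    apply: (le_trans (l2normB _ _)).
    have h0 := NP _ x NS; rewrite l2normZ cabs_half.
    have h1 := l2normD (B (B x) - sqrt_iter N (B x))
                       (sqrt_iter N (B x - sqrt_iter N x)).
    have h2 := le_trans (NP N (B x) (leqnn N)) (ler_wpM2l (ltW e0) (B1 x)).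
    have h3 := le_trans (Bn1 N _) (NP N x (leqnn N)).
    by lra.
  have /(congr1 (fun v : V => 2 *: v)) : B x = 2^-1 *: (x - Y (Y x) + B (B x)) by [].
  rewrite scalerA divff// scale1r => E; rewrite linB//.
  have -> : x - B x - (B x - B (B x)) = x + B (B x) - 2 *: B x.
    by apply: ell2_inj => h; rewrite !ell2E; ring.
  by rewrite E; apply: ell2_inj => h; rewrite !ell2E; ring.
Qed.

End iteration.

End square_root.

(** * Annihilator ideals of a central element *)

Section annihilators.
Local Open Scope ring_scope.
Context {R : realType} {G : choiceType}.
Local Notation V := (ell2 R G).
Local Notation center := Defs.center.
Implicit Types (x y v : V) (S T W : V -> V) (A J : set (V -> V)).

Lemma comp_fun0 T : linear T -> T \o 0 = 0 :> (V -> V).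
Proof. by move=> lT; apply/funext => x; exact: lin0. Qed.

Lemma comp_eq0_limit J W T : bounded_operator W -> bounded_operator T ->
  (forall S, J S -> bounded_operator S /\ W \o S = 0) ->
  (forall e : R, 0 < e -> exists2 S, J S & opnorm (T - S) < e) -> W \o T = 0.
Proof.
move=> bW bT JP lim; apply/funext => x /=.
have [M M0 MP] := bounded_operatorP bW; have [lW _] := bW.
apply: (@dist_le_small _ _ _ (M * l2norm x)) => e /lim[S /JP[bS WS] lt].
have -> : W (T x) = W (T x - S x).
  by rewrite linB// -[W (S x)]/((W \o S) x) WS subr0.
apply: (le_trans (MP _)); rewrite mulrCA ler_wpM2l ?(ltW M0)//.
exact: opnorm_lt_dist.
Qed.

Lemma eq0_comp_limit J W T : bounded_operator W -> bounded_operator T ->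
  (forall S, J S -> bounded_operator S /\ S \o W = 0) ->
  (forall e : R, 0 < e -> exists2 S, J S & opnorm (T - S) < e) -> T \o W = 0.
Proof.
move=> bW bT JP lim; apply/funext => x /=.
apply: (@dist_le_small _ _ _ (l2norm (W x))) => e /lim[S /JP[bS SW] lt].
have := opnorm_lt_dist (W x) bT bS lt.
by rewrite -[S (W x)]/((S \o W) x) SW subr0.
Qed.

Definition annihilator A W : set (V -> V) := [set T | A T /\ W \o T = 0].

(** Two-sided annihilator of the ideal [annihilator A W]. For central [W] it contains [W], which is
    how a nonzero element of it is found. *)
Definition biannihilator A W : set (V -> V) := [set T | A T /\
  forall S, annihilator A W S -> T \o S = 0 /\ S \o T = 0].

Lemma annihilator_ideal A W : cstar_subalgebra A -> center A W ->
  closed_ideal A (annihilator A W).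
Proof.
move=> [bA [A0 Al] Ac _ _] [AW cW]; have bW := bA _ AW; have [lW _] := bW.
split.
- by move=> T [].
- split; first by split=> //; exact: comp_fun0.
  move=> a S T [AS WS] [AT WT]; split; first exact: Al.
  apply/funext => x; rewrite /= fun_linE lW.
  by rewrite -[W (S x)]/((W \o S) x) -[W (T x)]/((W \o T) x) WS WT scaler0 addr0.
- move=> S T AS [AT WT]; split; split; [exact: Ac| |exact: Ac|].
    by rewrite compA cW// -compA WT; apply: comp_fun0; have [] := bA _ AS.
  by rewrite compA WT.
- move=> T AT lim; split=> //; apply: comp_eq0_limit lim => //; first exact: bA.
  by move=> S [/bA].
Qed.

Lemma biannihilator_ideal A W : cstar_subalgebra A -> center A W ->
  closed_ideal A (biannihilator A W).
Proof.
move=> cA cW; have [_ _ IM _] := annihilator_ideal cA cW.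
have [bA [A0 Al] Ac _ _] := cA.
split.
- by move=> T [].
- split.
    split=> // S [AS _]; split=> //.
    by apply: comp_fun0; have [] := bA _ AS.
  move=> a S T [AS KS] [AT KT]; split; first exact: Al.
  move=> U IU; have [SU US] := KS U IU; have [TU UT] := KT U IU.
  have [lU _] := bA _ (proj1 IU); split; apply/funext => x.
    rewrite /= fun_linE -[S (U x)]/((S \o U) x) -[T (U x)]/((T \o U) x).
    by rewrite SU TU scaler0 addr0.
  rewrite /= fun_linE lU -[U (S x)]/((U \o S) x) -[U (T x)]/((U \o T) x).
  by rewrite US UT scaler0 addr0.
- move=> S T AS [AT KT]; split; split; [exact: Ac| |exact: Ac|] => U IU.
    have [TU UT] := KT U IU; have [_ TUS] := KT _ (proj2 (IM _ _ AS IU)).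
    split; last by rewrite compA.
    by rewrite -compA TU; apply: comp_fun0; have [] := bA _ AS.
  have [TU UT] := KT U IU; have [TSU _] := KT _ (proj1 (IM _ _ AS IU)).
  by split; [rewrite -compA | rewrite compA UT].
- move=> T AT lim; split=> // U IU; have bU := bA _ (proj1 IU).
  split; [apply: eq0_comp_limit lim|apply: comp_eq0_limit lim] => //;
    [exact: bA| |exact: bA|] => S [AS KS];
    by have [] := KS U IU; have := bA _ AS.
Qed.

(* If [T] lies in both ideals then so does [T^*], hence [T^* T = 0]. *)
Lemma annihilator_biannihilator A W : cstar_subalgebra A -> center A W ->
  is_adjoint W W -> annihilator A W `&` biannihilator A W = [set 0].
Proof.
move=> cA cW WW; have [_ [I0 _] _ _] := annihilator_ideal cA cW.
have [_ [K0 _] _ _] := biannihilator_ideal cA cW.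
have [_ _ _ adj _] := cA; have [AW comW] := cW.
apply/seteqP; split=> [T [[AT WT] [_ KT]]|_ ->//].
have [T' AT' TT'] := adj T AT.
(* [W \o T'] is the adjoint of [T \o W], which is [W \o T = 0] by centrality. *)
have IT' : annihilator A W T'.
  split=> //; have TW0 : T \o W = 0 by rewrite -comW.
  apply/funext => x; apply: inner_inj => z /=.
  rewrite [(0 : V -> V) x](_ : _ = 0)// inner0l WW (is_adjoint_sym TT').
  by rewrite -[T (W z)]/((T \o W) z) TW0 inner0r.
have [_ T'T] := KT _ IT'.
apply/funext => x; apply: nsq_eq0; rewrite nsqE TT'.
by rewrite -[T' (T x)]/((T' \o T) x) T'T inner0r.
Qed.

(* With [C = |Y|], the central elements [C + Y] and [C - Y] have product zero,
   so in a prime algebra [Y = C] or [Y = - C], and [Y] is semidefinite. *)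
Lemma prime_center_semidefinite A X v : cstar_subalgebra A -> A idfun ->
  prime_algebra A -> center A X -> is_adjoint X X -> inner (X v) v = 0 ->
  X v = 0.
Proof.
move=> cA A1 pA cX XX Xv.
have [bA _ _ _ _] := cA; have bX := bA _ (proj1 cX).
have [M M0 MP] := bounded_operatorP bX.
have Mi0 : 0 <= M^-1 by rewrite invr_ge0 ltW.
(* Rescaling makes the operator a contraction, as the square root iteration requires. *)
pose m : R[i] := (M^-1)%:C%C; have mn0 : m != 0.
  by rewrite /m fmorph_eq0 invr_eq0 gt_eqF.
pose Y := m *: X.
have cY : center A Y by exact: center_scale.
have YY : is_adjoint Y Y.
  move=> x y; rewrite /Y [(m *: X) x](_ : _ = m *: X x)//.
  rewrite [(m *: X) y](_ : _ = m *: X y)// innerZl innerZr XX; congr (_ * _).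
  by rewrite /m /Num.conj /= oppr0.
have Y1 x : l2norm (Y x) <= l2norm x.
  rewrite /Y [(m *: X) x](_ : _ = m *: X x)// l2normZ cabs_real//.
  by rewrite mulrC ler_pdivrMr// mulrC MP.
have Yv : inner (Y v) v = 0.
  by rewrite /Y [(m *: X) v](_ : _ = m *: X v)// innerZl Xv mulr0.
suff Yv0 : Y v = 0.
  move: Yv0; rewrite /Y [(m *: X) v](_ : _ = m *: X v)//.
  move=> /(congr1 (fun u : V => m^-1 *: u)).
  by rewrite scalerA mulVf// scale1r scaler0.
have [B [cB BB B1 sqB]] := contraction_sqrt cA A1 cY YY Y1.
pose C : V -> V := -1 *: B + idfun.
have CE x : C x = x - B x by rewrite /C fun_linE scaleN1r addrC.
have cC : center A C by apply: center_lin => //; exact: center_id.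
have CC : is_adjoint C C.
  by move=> x y; rewrite !CE innerBl innerBr BB.
(* Then [inner (B v) v = nsq v] while [B] is a contraction, which forces [B v = v]. Hence [C v = 0],
   so [Y (Y v) = 0], and [Y v = 0] by self-adjointness. *)
have Cv0 : inner (C v) v = 0 -> Y v = 0.
  move=> Cv; have Bv : B v = v.
    apply/eqP; rewrite -subr_eq0; apply/eqP/nsq_eq0/eqP.
    rewrite eq_le nsq_ge0 andbT nsqB.
    have : inner (B v) v = inner v v.
      by apply/eqP; rewrite eq_sym -subr_eq0 -innerBl -CE Cv.
    move=> ->; rewrite inner_xx /=.
    have : nsq (B v) <= nsq v by rewrite -!l2norm_sqr ler_pXn2r// ?nnegrE ?l2norm_ge0.
    by lra.
  have := sqB v; rewrite Bv subrr.
  have [lB _] := bA _ (proj1 cB); rewrite lin0// subr0 => YYv.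
  by apply: nsq_eq0; rewrite nsqE YY -YYv inner0r.
pose W := 1 *: C + Y; pose Z := -1 *: Y + C.
have cW : center A W by exact: center_lin.
have cZ : center A Z by exact: center_lin.
have WE x : W x = C x + Y x by rewrite /W fun_linE scale1r.
have ZE x : Z x = C x - Y x by rewrite /Z fun_linE scaleN1r addrC.
have WW : is_adjoint W W.
  by move=> x y; rewrite !WE innerDl innerDr CC YY.
have IZ : annihilator A W Z.
  split; first exact: (proj1 cZ).
  apply/funext => x; rewrite /= WE ZE.
  have lC : linear C by have [] := bA _ (proj1 cC).
  have lY : linear Y by have [] := bA _ (proj1 cY).
  rewrite (linB _ _ lC) (linB _ _ lY).
  rewrite [C (Y x)](congr1 (@^~ x) (proj2 cC Y (proj1 cY))).
  by rewrite -[(Y \o C) x]/(Y (C x)) addrA subrK !CE sqB subrr.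
have KW : biannihilator A W W.
  split; first exact: (proj1 cW).
  move=> S [AS WS]; split=> //.
  by rewrite -(proj2 cW).
have pW := pA _ _ (annihilator_ideal cA cW) (biannihilator_ideal cA cW).
have [Z0|Zn0] := pselect (Z = 0).
  apply: Cv0; have /eqP : Z v = 0 by rewrite Z0.
  by rewrite ZE subr_eq0 => /eqP ->.
have [W0|Wn0] := pselect (W = 0).
  apply: Cv0; have /eqP : W v = 0 by rewrite W0.
  by rewrite WE addr_eq0 => /eqP ->; rewrite innerNl Yv oppr0.
exfalso; apply: pW (annihilator_biannihilator cA cW WW) => I0.
  by apply: Zn0; move: IZ; rewrite I0.
by apply: Wn0; move: KW; rewrite I0.
Qed.

End annihilators.

(** * Failure of the relative Kleppner condition *)

Section witness.
Local Open Scope ring_scope.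
Context {R : realType} {G : groupType} (sigma : two_cocycle R G).
Local Notation V := (ell2 R G).
Local Notation e := (1%g : G).
Implicit Types (x y : V) (g h k s t : G).
Context (H : set G) (subgroup_H : group_closed [in H]).

Lemma cstar_r_cstar : cstar_subalgebra (cstar_r sigma setT).
Proof.
apply: (@smallest_cstar _ _ _ (commutant (right_unitaries sigma))).
  by apply: unitary_commutant_cstar => W [].
by move=> T lT; apply: cstar_r_commutant => A [_]; exact.
Qed.

Lemma cstar_r_lambda g : cstar_r sigma setT (lambda sigma g).
Proof. by move=> A [_]; apply; exists g. Qed.

Lemma cstar_r_eq S T : cstar_r sigma setT S -> cstar_r sigma setT T ->
  S (delta e) = T (delta e) -> S = T.
Proof.
move=> rS rT ST; apply: bounded_eq_on_delta;
  [exact: cstar_r_bounded rS | exact: cstar_r_bounded rT |].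
have [lS _] := cstar_r_bounded rS; have [lT _] := cstar_r_bounded rT => g.
by rewrite (delta_rho sigma) (linZ _ _ lS) (linZ _ _ lT)
  (cstar_r_rho _ _ rS) (cstar_r_rho _ _ rT) ST.
Qed.

(* The coefficient at [h g h^-1] of the element of C*_r(G, sigma) obtained by
   summing the conjugates [lambda h * lambda g * (lambda h)^-1]. *)
Definition conj_coef g h : R[i] := sigma h g / sigma (h * g * h^-1)%g h.

(** Regularity enters here: the cocycle identities for [(s, t, g)], [(k, s, t)] and [(s, g, t)] show
    that the two coefficients differ by the factor [sigma t g / sigma g t]. *)
Lemma conj_coef_centralizer g s t : regular_wrt sigma H g -> H t ->
  (g * t = t * g)%g -> conj_coef g (s * t) = conj_coef g s.
Proof.
move=> rg Ht gt; rewrite /conj_coef.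
have -> : (s * t * g * (s * t)^-1 = s * g * s^-1)%g.
  by rewrite invgM !mulgA -(mulgA s t g) -gt mulgA mulgK.
set k := (s * g * s^-1)%g; have ks : (k * s = s * g)%g by rewrite /k mulgVK.
have E1 := cocycleM sigma s t g; have E2 := cocycleM sigma k s t.
have E3 := cocycleM sigma s g t; rewrite ks in E2; rewrite -gt in E1.
have E4 := rg t Ht gt.
have n := cocycle_neq0 sigma.
apply/eqP; rewrite eqr_div ?n//; apply/eqP.
rewrite -E4 -E3 in E1; apply: (mulIf (n s t)); apply: (mulIf (n (s * g)%g t)).
transitivity (sigma s t * sigma (s * t)%g g * (sigma k s * sigma (s * g)%g t)).
  by ring.
by rewrite E1 E2; ring.
Qed.

(** Two elements of [H] conjugating [g] to the same point differ by [s^-1 * h], which commutes with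
    [g]; the coefficient thus depends only on the point of the class. *)
Lemma conj_coef_class g h s : regular_wrt sigma H g -> H h -> H s ->
  (h * g * h^-1)%g = (s * g * s^-1)%g -> conj_coef g h = conj_coef g s.
Proof.
move=> rg Hh Hs hs; rewrite -(mulVKg s h); apply: conj_coef_centralizer => //.
  by apply: subgroupM => //; apply: subgroupV.
apply: (mulgI s); apply: (mulIg h^-1%g); rewrite !mulgA mulgK mulgV mul1g.
exact/esym.
Qed.

(** With [k = s * g * s^-1], the quotient is the phase in [lambda h * lambda k * (lambda h)^-1]
    relative to [lambda (h * k * h^-1)]; conjugating by [s] and then by [h] is conjugating by
    [h * s]. *)
Lemma conj_coef_shift g h s : sigma h (s * g * s^-1)%g /
    sigma (h * (s * g * s^-1) * h^-1)%g h * conj_coef g s = conj_coef g (h * s).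
Proof.
rewrite /conj_coef; have n := cocycle_neq0 sigma.
have -> : (h * s * g * (h * s)^-1 = h * (s * g * s^-1) * h^-1)%g.
  by rewrite invgM !mulgA.
set k := (s * g * s^-1)%g; set l := (h * k * h^-1)%g.
have ks : (k * s = s * g)%g by rewrite /k mulgVK.
have lh : (l * h = h * k)%g by rewrite /l mulgVK.
have E1 := cocycleM sigma l h s; rewrite lh in E1.
have E2 := cocycleM sigma h s g; have E3 := cocycleM sigma h k s.
rewrite ks in E3.
rewrite mulf_div; apply/eqP; rewrite eqr_div ?mulf_neq0//; apply/eqP.
apply: (mulIf (n h s)); apply: (mulIf (n (h * k)%g s)).
transitivity (sigma h k * sigma (h * k)%g s * sigma s g *
  (sigma l (h * s)%g * sigma h s)); first by ring.
rewrite E3 -E1; transitivity (sigma h (s * g)%g * sigma s g * sigma k s *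
  sigma l h * sigma (h * k)%g s); first by ring.
by rewrite -E2; ring.
Qed.

Lemma not_Kleppner_central : ~ relative_Kleppner sigma H ->
  exists T : V -> V, [/\ cstar_r sigma setT T,
    forall h, H h -> T \o lambda sigma h = lambda sigma h \o T,
    T (delta e) <> 0 & (T (delta e)) e = 0].
Proof.
move=> nK.
have [g [gn1 rg fin]] : exists g, [/\ g <> e, regular_wrt sigma H g &
    finite_set (conj_class H g)].
  apply: contrapT => nE; apply: nK => g gn1 rg fin; apply: nE.
  by exists g.
set C := conj_class H g in fin *.
(* A conjugator in [H] for each point of the class, with the default [e] elsewhere; [cE] shows that
   the coefficients do not depend on the choice. *)
have /choice[r rP] : forall k, exists h, C k -> H h /\ (h * g * h^-1 = k)%g.
  move=> k; have [[h Hh hk]|nC] := pselect (C k); first by exists h.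
  by exists e.
have CH h k : H h -> C k -> C (h * k * h^-1)%g.
  move=> Hh [s Hs <-]; exists (h * s)%g; first exact: subgroupM.
  by rewrite invgM !mulgA.
pose c k := conj_coef g (r k).
have cE h : H h -> c (h * g * h^-1)%g = conj_coef g h.
  move=> Hh; have [|Hr rk] := rP (h * g * h^-1)%g; first by exists h.
  exact: conj_coef_class.
have c0 k : c k != 0.
  by rewrite /c /conj_coef mulf_neq0 ?invr_neq0 ?cocycle_neq0.
pose T : V -> V := \sum_(k <- fset_set C) c k *: lambda sigma k.
have TE x : T x = \sum_(k <- fset_set C) c k *: lambda sigma k x.
  by rewrite /T; elim/big_ind2 : _ => // S1 y1 S2 y2 <- <-.
have Te k : T (delta e) k = if k \in fset_set C then c k else 0.
  rewrite TE -sum_delta; congr (ell2_val _ k); apply: eq_bigr => h _.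
  by rewrite lambda_delta cocycleg1 scale1r mulg1.
have inC k : (k \in fset_set C) = (k \in C) by rewrite in_fset_set.
have rT : cstar_r sigma setT T.
  have [_ [A0 Al] _ _ _] := cstar_r_cstar.
  rewrite /T; elim: (enum_fset _) => [|k l IH]; first by rewrite big_nil.
  by rewrite big_cons; apply: Al => //; exact: cstar_r_lambda.
have [_ _ Ac _ _] := cstar_r_cstar.
have fT h : H h -> conj_shift sigma h (T (delta e)) = T (delta e).
  move=> Hh; apply: ell2_inj => k; rewrite conj_shiftE !Te !inC.
  have -> : ((h^-1 * k * h)%g \in C) = (k \in C).
    apply/idP/idP => /set_mem Ck; apply: mem_set.
      have := CH h _ Hh Ck; rewrite !mulgA mulgV mul1g -mulgA mulgV mulg1.
      by [].
    have := CH h^-1%g _ (subgroupV subgroup_H Hh) Ck; rewrite invgK.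
    by [].
  case: ifPn => [/set_mem Ck|_]; last by rewrite mulr0.
  have [s Hs sk] := CH h^-1%g _ (subgroupV subgroup_H Hh) Ck.
  rewrite invgK in sk; rewrite -sk (cE _ Hs) cocycle_conjV.
  have kE : (k = h * (s * g * s^-1) * h^-1)%g.
    by rewrite sk !mulgA mulgV mul1g mulgK.
  have -> : c k = conj_coef g (h * s)%g.
    have -> : k = ((h * s) * g * (h * s)^-1)%g by rewrite kE invgM !mulgA.
    by apply: cE; exact: subgroupM.
  rewrite -conj_coef_shift -kE; congr (_ * _).
  (* This identity matches the phase of [conj_shift] at [k] with the phase in [conj_coef_shift]. *)
  have := cocycleM sigma h (h^-1 * k)%g h; rewrite mulVKg -sk => E.
  have n := cocycle_neq0 sigma.
  by apply/eqP; rewrite eqr_div ?n// E mulrC.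
exists T; split=> //.
- move=> h Hh; apply: cstar_r_eq.
  + by apply: Ac => //; exact: cstar_r_lambda.
  + by apply: Ac => //; exact: cstar_r_lambda.
  (* After the injective [rho h], one side is [T] applied to the shifted [delta e] and the other is
     the shift of [T (delta e)]; both equal [T (delta e)]. *)
  + have [_ [W [rK _ _]]] := rho_unitary sigma h; apply: (can_inj rK) => /=.
    rewrite -(cstar_r_rho _ _ rT) -!lambda_rho_comm -!/(conj_shift sigma h _).
    by rewrite conj_shift_delta fT.
- move=> T0; have := Te g; rewrite T0 ell20 inC mem_set.
    by move=> /esym/eqP; rewrite (negPf (c0 g)).
  by exists e; [exact: subgroup1 | rewrite invg1 mulg1 mul1g].
- rewrite Te inC memNset// => -[h _ hg]; apply: gn1.
  apply: (mulgI h); apply: (mulIg h^-1%g).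
  by rewrite hg mulg1 mulgV.
Qed.

(** For every scalar [a], [a T] plus its adjoint is self-adjoint and keeps the other properties. If
    these sums vanished at [delta e] both for [a = 1] and for [a = 'i], then so would [T]. *)
Lemma not_Kleppner_witness : ~ relative_Kleppner sigma H ->
  exists X : V -> V, [/\ cstar_r sigma setT X, is_adjoint X X,
    forall h, H h -> X \o lambda sigma h = lambda sigma h \o X,
    X (delta e) <> 0 & (X (delta e)) e = 0].
Proof.
move=> /not_Kleppner_central[T [rT cT T0 Te]].
have [_ [A0 Al] _ adj _] := cstar_r_cstar; have [T' rT' TT'] := adj T rT.
have cT' h : H h -> T' \o lambda sigma h = lambda sigma h \o T'.
  by move=> Hh; apply: unitary_commute_adjoint TT' (cT h Hh); exact: lambda_unitary.
have T'e : (T' (delta e)) e = 0.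
  rewrite -inner_delta (is_adjoint_sym TT') inner_conj inner_delta Te.
  exact: conjC0.
(* The trailing 0 puts both sums in the form [a *: S + T] of the closure axiom. *)
pose X (a : R[i]) : V -> V := a *: T + (a^* *: T' + 0).
have XE a x : X a x = a *: T x + a^* *: T' x.
  by rewrite /X fun_linE fun_linE [(0 : V -> V) x](_ : _ = 0)// addr0.
suff [a Xa] : exists a, X a (delta e) <> 0.
  exists (X a); split=> //.
  - by apply: (Al) => //; exact: Al.
  - move=> x y; rewrite !XE innerDl innerDr !innerZl !innerZr conjCK TT'.
    by rewrite (is_adjoint_sym TT') addrC.
  - move=> h Hh; have [lL _] := lambda_unitary sigma h.
    apply/funext => x /=; rewrite !XE (linD _ _ lL) !(linZ _ _ lL).
    by rewrite [T (lambda _ _ _)](congr1 (@^~ x) (cT h Hh))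
      [T' (lambda _ _ _)](congr1 (@^~ x) (cT' h Hh)).
  - by rewrite XE !ell2E Te T'e !mulr0 addr0.
apply: contrapT => nX.
have X0 a : X a (delta e) = 0 by apply: contrapT => Xa; apply: nX; exists a.
apply: T0.
have := X0 1; have := X0 'i%C; rewrite !XE conjC1 !scale1r.
have -> : ('i%C : R[i])^* = - 'i%C by apply/eqP; rewrite eq_complex /= oppr0 !eqxx.
rewrite scaleNr -scalerBr => /(congr1 (fun v : V => 'i%C *: v)).
rewrite scalerA scaler0 -expr2 sqr_i scaleN1r => /eqP; rewrite oppr_eq0 subr_eq0.
move=> /eqP <- /(congr1 (fun v : V => 2^-1 *: v)).
by rewrite -[T _ in X in _ *: X]scale1r -scalerDl scalerA mulVf// scale1r scaler0.
Qed.

Lemma not_Kleppner_algebra : ~ relative_Kleppner sigma H ->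
  exists A, [/\ cstar_subalgebra A, cstar_r sigma H `<=` A,
    A `<=` cstar_r sigma setT & exists X, [/\ Defs.center A X, is_adjoint X X,
    X (delta e) <> 0 & (X (delta e)) e = 0]].
Proof.
move=> /not_Kleppner_witness[X [rX XX cX X0 Xe]].
pose P : set (V -> V) := (lambda sigma @` H) `|` [set X].
have PG : P `<=` cstar_r sigma setT.
  by move=> _ [[h _ <-]|->//]; exact: cstar_r_lambda.
have cA : cstar_subalgebra (smallest cstar_subalgebra P).
  exact: smallest_cstar cstar_r_cstar PG.
exists (smallest cstar_subalgebra P); split=> //.
- apply: smallest_sub => // _ [h Hh <-].
  by apply: sub_gen_smallest; left; exists h.
- by apply: smallest_sub => //; exact: cstar_r_cstar.
exists X; split=> //; split; first by move=> B [_]; apply; right.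
have bX := cstar_r_bounded rX.
have : smallest cstar_subalgebra P `<=` commutant [set X].
  apply: smallest_sub; first exact: self_adjoint_commutant_cstar.
  move=> _ [[h Hh <-]|->].
    split; first exact: unitary_bounded (lambda_unitary sigma h).
    by move=> _ ->; rewrite cX.
  by split=> // _ ->.
by move=> AX S /AX[_ /(_ X erefl)].
Qed.

End witness.

Theorem corollary4p6 (R : realType) (G : groupType) (sigma : two_cocycle R G)
    (H : set G) (subgroup_H : group_closed [in H]) :
  (relative_Kleppner sigma H <->
   forall A : set (ell2 R G -> ell2 R G), cstar_subalgebra A ->
     cstar_r sigma H `<=` A -> A `<=` cstar_r sigma setT -> prime_algebra A) /\
  (relative_Kleppner sigma H <->
   forall A : set (ell2 R G -> ell2 R G), cstar_subalgebra A ->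
     cstar_r sigma H `<=` A -> A `<=` cstar_r sigma setT -> trivial_center A).
Proof.
split; split.
- by move=> kH A; exact: Kleppner_prime.
- move=> pA; apply: contrapT => /(not_Kleppner_algebra subgroup_H).
  move=> [A [cA HA AG [X [cX XX X0 Xe]]]]; apply: X0.
  apply: (prime_center_semidefinite cA _ (pA A cA HA AG) cX XX).
    rewrite -(lambda1 sigma); apply: HA => B [_]; apply.
    by exists 1%g => //; exact: subgroup1.
  by rewrite inner_delta.
- by move=> kH A; exact: Kleppner_trivial_center.
- move=> tA; apply: contrapT => /(not_Kleppner_algebra subgroup_H).
  move=> [A [cA HA AG [X [cX XX X0 Xe]]]]; apply: X0.
  (* A scalar operator is read off from its coefficient at the identity, which is 0 for [X]. *)
  have [a _ Xa] : range (fun a : R[i] => a *: (idfun : ell2 R G -> ell2 R G))%R X.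
    by rewrite -(tA A cA HA AG).
  move: Xe; rewrite -Xa [X in ell2_val X _](_ : _ = a *: delta 1%g)%R//.
  rewrite ell2Z deltaE eqxx mulr1 => ->.
  exact: scale0r.
Qed.
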